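(* Let $\{\theta_k\}$ be generated by $\theta_{k+1}=\theta_k+\alpha_k(F(X_k,\theta_k)+w_k)$ from $\theta_0\in\mathbb{R}^d$, and suppose that the assumptions (A1), (A2), (A3) in the context are satisfied. When $\alpha_k\equiv\alpha$ with $\alpha\in(0,1)$ chosen such that $\alpha t_\alpha\le\frac{c_0}{130L^2}$, we have $$\mathbb{E}[\|\theta_k-\theta^*\|^2]\le\beta_1(1-c_0\alpha)^{k-t_\alpha}+\beta_2\frac{\alpha t_\alpha}{c_0},\qquad\forall\,k\ge t_\alpha,$$ where $\beta_1=(\|\theta_0\|+\|\theta_0-\theta^*\|+1)^2$ and $\beta_2=130L^2(\|\theta^*\|+1)^2$.
   Context: $\|\cdot\|$ is the Euclidean norm. $\mathcal{X}\subseteq\mathbb{R}^{n_X}$, $F:\mathcal{X}\times\mathbb{R}^d\to\mathbb{R}^d$, $\{X_k\}_{k\ge0}$ is a Markov chain on $\mathcal{X}$ with transition kernel $P$ and stationary distribution $\mu_X$, and $\bar F(\theta)=\mathbb{E}_{X\sim\mu_X}[F(X,\theta)]$. The initial point $\theta_0\in\mathbb{R}^d$ is given and $\{w_k\}$ is an $\mathbb{R}^d$-valued noise sequence (possibly depending on $\{\theta_k\}$). $\mathcal{F}_k$ is the $\sigma$-algebra generated by $\{\theta_i,X_i,w_i\}_{0\le i\le k-1}\cup\{\theta_k,X_k\}$. $\|\cdot\|_{\mathrm{TV}}$ is total variation distance ($\sup_A|\mu(A)-\nu(A)|$). (A1) There is $L_1>0$ such that $\|F(x,\theta_1)-F(x,\theta_2)\|\le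 L_1\|\theta_1-\theta_2\|$ for all $\theta_1,\theta_2,x$, and $\|F(x,0)\|\le L_1$ for all $x$. (A2) The equation $\bar F(\theta)=0$ has a unique solution $\theta^*$, and there is $c_0>0$ such that $(\theta-\theta^* )^\top\bar F(\theta)\le -c_0\|\theta-\theta^*\|^2$ for all $\theta\in\mathbb{R}^d$. (A3) (1) $\{X_k\}$ is uniformly geometrically ergodic with unique stationary distribution $\mu_X$: there are $C\ge1$, $\rho\in(0,1)$ with $\sup_{x\in\mathcal{X}}\|P^k(x,\cdot)-\mu_X(\cdot)\|_{\mathrm{TV}}\le C\rho^k$ for all $k\ge0$. (2) $\mathbb{E}[w_k\mid\mathcal{F}_k]=0$ and $\|w_k\|\le L_2(\|\theta_k\|+1)$ for all $k\ge0$, where $L_2>0$ is a constant. Notation: $L=L_1+L_2$, with the standing convention $L\ge1$. For $\delta>0$ the mixing time is $t_\delta=\min\{k\ge0:\sup_{x\in\mathcal{X}}\|P^k(x,\cdot)-\mu_X(\cdot)\|_{\mathrm{TV}}\le\delta\}$.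
   Formalization: The formal theorem additionally assumes t_α ≥ 1 (the bound can fail when t_α = 0, e.g. a one-point state space with nonzero noise w_k) and d ≥ 1. *)

(* Defs.v *)
(* MathComp + MathComp-Analysis *)
From HB Require Import structures.
From mathcomp Require Import all_boot all_order all_algebra.
From mathcomp Require Import all_classical all_reals all_analysis.

Set Implicit Arguments.
Unset Strict Implicit.
Unset Printing Implicit Defensive.

Import Order.TTheory GRing.Theory Num.Theory.
Import numFieldNormedType.Exports.

Local Open Scope classical_set_scope.
Local Open Scope ring_scope.

(* The Borel sigma-algebra of R^n, generated by the n coordinates
   (as the library does for n.-tuple R).  The library topology of 'rV[R]_n is
   not used here, and its norm `|v| is the sup norm, hence [enorm] below. *)
Section borel_rV.
Context {R : realType} {n : nat}.

Definition rV_display : measure_display :=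
  measure_tuple_display default_measure_display.

Let coord (i : 'I_n) (v : 'rV[R]_n) : R := v 0 i.

Let rV_set0 : g_sigma_preimage coord set0.
Proof. exact: sigma_algebra0. Qed.

Let rV_setC A : g_sigma_preimage coord A -> g_sigma_preimage coord (~` A).
Proof. exact: sigma_algebraC. Qed.

Let rV_bigcup (A : (set 'rV[R]_n)^nat) :
  (forall i, g_sigma_preimage coord (A i)) ->
  g_sigma_preimage coord (\bigcup_i A i).
Proof. exact: sigma_algebra_bigcup. Qed.

HB.instance Definition _ := @isMeasurable.Build rV_display 'rV[R]_n
  (g_sigma_preimage coord) rV_set0 rV_setC rV_bigcup.

End borel_rV.

(* A subset S of R^n as a measurable space, with the trace of the Borel
   sigma-algebra; the nonemptiness proof is there because measurable types
   are pointed. *)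
Definition subspaceType (R : realType) (n : nat) (S : set 'rV[R]_n)
  (S0 : S !=set0) : Type := {x : 'rV[R]_n | x \in S}.

Section subspace.
Context {R : realType} {n : nat} {S : set 'rV[R]_n} (S0 : S !=set0).
Local Notation T := (subspaceType S0).

HB.instance Definition _ := Choice.copy T {x : 'rV[R]_n | x \in S}.

HB.instance Definition _ := isPointed.Build T
  (exist (fun x => x \in S) (projT1 (cid S0)) (mem_set (projT2 (cid S0)))).

Let emb : T -> 'rV[R]_n := sval.

HB.instance Definition _ := Measurable.copy T (g_sigma_algebra_preimageType emb).

End subspace.

Section euclidean.
Context {R : realType} {n : nat}.
Implicit Types u v : 'rV[R]_n.

Definition dotv u v : R := \sum_(i < n) u 0 i * v 0 i.

Definition enorm v : R := Num.sqrt (\sum_(i < n) v 0 i ^+ 2).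

End euclidean.

Section markov_kernels.
Context {d : measure_display} {S : measurableType d} {R : realType}.
Implicit Types (K : R.-pker S ~> S) (mu nu : probability S R).

Fixpoint kpow K (k : nat) : R.-spker S ~> S :=
  if k is k'.+1 then mkcomp_noparam (kpow K k') K
  else kdirac (@measurable_id _ S setT).

Definition tv_dist (m1 m2 : set S -> \bar R) : \bar R :=
  ereal_sup [set `|m1 A - m2 A|%E | A in measurable].

Definition mixing_dist K mu (k : nat) : \bar R :=
  ereal_sup [set tv_dist (kpow K k x) mu | x in [set: S]].

(* The default value 0 is only taken when [mixing_dist] never gets below
   delta, which uniform geometric ergodicity excludes for delta > 0.
   A genuine value 0 means that every Dirac mass is already delta-close to mu,
   as [kpow K 0 x] is the Dirac mass at x. *)
Definition mixing_time K mu (delta : R) : nat :=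
  xget 0%N [set k | (mixing_dist K mu k <= delta%:E)%E /\
    forall j, (mixing_dist K mu j <= delta%:E)%E -> (k <= j)%N].

Definition stationary K mu : Prop :=
  forall A, measurable A -> (\int[mu]_x K x A = mu A)%E.

Definition uniformly_geometrically_ergodic K mu : Prop :=
  [/\ stationary K mu,
      forall nu, stationary K nu ->
        forall A, measurable A -> nu A = mu A
    & exists C rho : R, [/\ 1 <= C, 0 < rho < 1 &
        forall k, (mixing_dist K mu k <= (C * rho ^+ k)%:E)%E]].

End markov_kernels.

Section processes.
Context {d : measure_display} {Omega : measurableType d} {R : realType}.
Variable Pr : probability Omega R.

(* Markov property relative to a filtration G to which X is adapted:
   Pr (X_{k+1} \in A | G_k) = K (X_k, A) almost surely. *)
Definition markov_chain d' (S : measurableType d') (G : nat -> set (set Omega))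
    (K : R.-pker S ~> S) (X : nat -> Omega -> S) : Prop :=
  forall k A B, measurable A -> G k B ->
    Pr (B `&` X k.+1 @^-1` A) = (\int[Pr]_(om in B) K (X k om) A)%E.

(* Z is a version of the conditional expectation of Y given G. *)
Definition is_cond_exp (G : set (set Omega)) (Y Z : Omega -> R) : Prop :=
  [/\ Pr.-integrable setT (EFin \o Y),
      Pr.-integrable setT (EFin \o Z),
      forall A, measurable A -> G (Z @^-1` A)
    & forall B, G B ->
        (\int[Pr]_(om in B) (Y om)%:E = \int[Pr]_(om in B) (Z om)%:E)%E].

End processes.

Section stochastic_approximation.
Context {d dS : measure_display} {Omega : measurableType d}
  {S : measurableType dS} {R : realType} {n : nat}.
Variables (F : S -> 'rV[R]_n -> 'rV[R]_n).

Definition mean_field (mu : probability S R) (theta : 'rV[R]_n) : 'rV[R]_n :=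
  \row_(j < n) \int[mu]_x (F x theta 0 j).

Definition sa_iterates (alpha : nat -> R) (X : nat -> Omega -> S)
    (w : nat -> Omega -> 'rV[R]_n) (theta0 : 'rV[R]_n)
    (theta : nat -> Omega -> 'rV[R]_n) : Prop :=
  (forall om, theta 0%N om = theta0) /\
  forall k om,
    theta k.+1 om = theta k om + alpha k *: (F (X k om) (theta k om) + w k om).

Definition history (theta : nat -> Omega -> 'rV[R]_n) (X : nat -> Omega -> S)
    (w : nat -> Omega -> 'rV[R]_n) (k : nat) : set (set Omega) :=
  <<s [set B | exists2 i, (i <= k)%N &
          exists2 A, measurable A & B = theta i @^-1` A] `|`
      [set B | exists2 i, (i <= k)%N &
          exists2 A, measurable A & B = X i @^-1` A] `|`
      [set B | exists2 i, (i < k)%N &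
          exists2 A, measurable A & B = w i @^-1` A] >>.

Definition lipschitz_operator (L1 : R) : Prop :=
  [/\ 0 < L1,
      forall theta1 theta2 x,
        enorm (F x theta1 - F x theta2) <= L1 * enorm (theta1 - theta2)
    & forall x, enorm (F x 0) <= L1].

Definition dissipative (mu : probability S R) (thetas : 'rV[R]_n) (c0 : R) :
    Prop :=
  [/\ mean_field mu thetas = 0,
      forall theta, mean_field mu theta = 0 -> theta = thetas,
      0 < c0
    & forall theta,
        dotv (theta - thetas) (mean_field mu theta)
          <= - c0 * enorm (theta - thetas) ^+ 2].

Definition martingale_noise (Pr : probability Omega R)
    (G : nat -> set (set Omega)) (theta w : nat -> Omega -> 'rV[R]_n) (L2 : R) :
    Prop :=
  [/\ 0 < L2,
      forall k (j : 'I_n), is_cond_exp Pr (G k) (fun om => w k om 0 j) (cst 0)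
    & forall k, {ae Pr, forall om,
        enorm (w k om) <= L2 * (enorm (theta k om) + 1)}].

End stochastic_approximation.

(* Main.v *)
Require Import Defs.
From HB Require Import structures.
From mathcomp Require Import all_boot all_order all_algebra.
From mathcomp Require Import all_classical all_reals all_analysis.
From mathcomp Require Import measurable_realfun ring lra.

Set Implicit Arguments.
Unset Strict Implicit.
Unset Printing Implicit Defensive.

Import Order.TTheory GRing.Theory Num.Theory.
Import numFieldNormedType.Exports.

Local Open Scope classical_set_scope.
Local Open Scope ring_scope.

(* Write D_k = |theta_k - theta_star| and t for the mixing time.  Expanding
   D_{k+1}^2, the drift contributes - 2 c0 alpha D_k^2 and the noise has zero
   mean.  To control the Markovian error F(X_k, theta_k) - Fbar(theta_k), freeze
   the iterate t steps in the past: a = theta_{k-t} is measurable with respect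
   to the history at time k - t, given which X_k has law K^t(X_{k-t}, .),
   within alpha of mu_X in total variation.  Hence the mean of
   (a - theta_star) . (F(X_k, a) - Fbar(a)) is O(alpha), and replacing theta_k by a
   costs O(alpha t) because |theta_k - a| = O(alpha t (|theta_k| + 1)).
   Altogether
     E D_{k+1}^2 <= (1 - 2 c0 alpha) E D_k^2
                    + 45 alpha^2 t L^2 (E D_k^2 + (|theta_star| + 1)^2),
   and the step-size condition turns this into a contraction of factor
   1 - c0 alpha.  The noise bound makes every iterate almost surely bounded, so
   that all the expectations involved are finite. *)

(** * Euclidean norm and Borel sets of R^n *)

Section euclidean_space.
Context {R : realType} {n : nat}.
Implicit Types (u v z : 'rV[R]_n) (a : R).

Lemma dotvC u v : dotv u v = dotv v u.
Proof. by apply: eq_bigr => i _; rewrite mulrC. Qed.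

Lemma dotvDl u v z : dotv (u + v) z = dotv u z + dotv v z.
Proof. by rewrite -big_split; apply: eq_bigr => i _; rewrite mxE mulrDl. Qed.

Lemma dotvZl a u v : dotv (a *: u) v = a * dotv u v.
Proof. by rewrite mulr_sumr; apply: eq_bigr => i _; rewrite mxE mulrA. Qed.

Lemma dotvNl u v : dotv (- u) v = - dotv u v.
Proof. by rewrite -scaleN1r dotvZl mulN1r. Qed.

Lemma dotvDr u v z : dotv z (u + v) = dotv z u + dotv z v.
Proof. by rewrite !(dotvC z) dotvDl. Qed.

Lemma dotvZr a u v : dotv v (a *: u) = a * dotv v u.
Proof. by rewrite !(dotvC v) dotvZl. Qed.

Lemma dotvNr u v : dotv v (- u) = - dotv v u.
Proof. by rewrite !(dotvC v) dotvNl. Qed.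

Lemma dotv0r u : dotv u 0 = 0.
Proof. by apply: big1 => i _; rewrite mxE mulr0. Qed.

Lemma sqr_enorm u : enorm u ^+ 2 = dotv u u.
Proof.
rewrite /enorm sqr_sqrtr; first by apply: eq_bigr => i _; rewrite expr2.
by apply: sumr_ge0 => i _; exact: sqr_ge0.
Qed.

Lemma enorm_ge0 u : 0 <= enorm u.
Proof. exact: sqrtr_ge0. Qed.

Lemma enorm0 : enorm (0 : 'rV[R]_n) = 0.
Proof. by apply/eqP; rewrite -sqrf_eq0 sqr_enorm dotv0r. Qed.

Lemma enorm0_eq0 u : enorm u = 0 -> u = 0.
Proof.
move=> u0; have /eqP : \sum_(i < n) u 0 i ^+ 2 = 0.
  have := sqr_enorm u; rewrite u0 expr0n/= => /esym uu.
  by rewrite -[RHS]uu; apply: eq_bigr => i _; rewrite expr2.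
rewrite psumr_eq0 => [/allP/= ui|i _]; last exact: sqr_ge0.
apply/rowP => i; rewrite mxE; apply/eqP; rewrite -sqrf_eq0.
by apply: ui; rewrite mem_index_enum.
Qed.

(** Cauchy-Schwarz: the square of [enorm (enorm v *: u - enorm u *: v)] is twice [enorm u * enorm v]
    times [enorm u * enorm v - dotv u v]. Vectors of norm 0 are set apart so that the positive
    factor can be cancelled. *)
Lemma dotv_enorm u v : dotv u v <= enorm u * enorm v.
Proof.
have [u0|u0] := eqVneq (enorm u) 0.
  by rewrite (enorm0_eq0 u0) dotvC dotv0r enorm0 mul0r.
have [v0|v0] := eqVneq (enorm v) 0.
  by rewrite (enorm0_eq0 v0) dotv0r enorm0 mulr0.
have uv : 0 < enorm u * enorm v by rewrite mulr_gt0 ?lt_def ?u0 ?v0 ?enorm_ge0.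
have := sqr_ge0 (enorm (enorm v *: u - enorm u *: v)).
rewrite sqr_enorm !(dotvDl, dotvDr, dotvNl, dotvNr, dotvZl, dotvZr).
rewrite -!sqr_enorm (dotvC v u) => uv_ge0.
rewrite -(ler_pM2l uv); nra.
Qed.

Lemma normr_dotv u v : `|dotv u v| <= enorm u * enorm v.
Proof.
rewrite ler_norml dotv_enorm andbT lerNl -dotvNl.
rewrite (le_trans (dotv_enorm _ _))// ler_wpM2r ?enorm_ge0//.
by rewrite -(@ler_pXn2r _ 2) ?nnegrE ?enorm_ge0// !sqr_enorm dotvNl dotvNr opprK.
Qed.

Lemma enormN u : enorm (- u) = enorm u.
Proof.
by apply/eqP; rewrite -(@eqrXn2 _ 2) ?enorm_ge0// !sqr_enorm dotvNl dotvNr opprK.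
Qed.

Lemma enormB u v : enorm (u - v) = enorm (v - u).
Proof. by rewrite -enormN opprB. Qed.

Lemma enormZ a u : 0 <= a -> enorm (a *: u) = a * enorm u.
Proof.
move=> a0; apply/eqP; rewrite -(@eqrXn2 _ 2) ?mulr_ge0 ?enorm_ge0//.
by rewrite exprMn !sqr_enorm dotvZl dotvZr mulrA expr2.
Qed.

Lemma ler_enormD u v : enorm (u + v) <= enorm u + enorm v.
Proof.
rewrite -(@ler_pXn2r _ 2) ?nnegrE ?addr_ge0 ?enorm_ge0// sqr_enorm.
rewrite dotvDl !dotvDr -!sqr_enorm (dotvC v u) sqrrD.
have := dotv_enorm u v; rewrite mulr2n; lra.
Qed.

Lemma ler_enorm_triangle u v z : enorm (u - z) <= enorm (u - v) + enorm (v - z).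
Proof. by rewrite -(subrKA v) ler_enormD. Qed.

Lemma normr_coord_enorm u i : `|u 0 i| <= enorm u.
Proof.
rewrite -(@ler_pXn2r _ 2) ?nnegrE ?enorm_ge0// real_normK ?num_real//.
rewrite sqr_enorm /dotv (bigD1 i)//= -expr2 lerDl.
by apply: sumr_ge0 => j _; rewrite -expr2 sqr_ge0.
Qed.

End euclidean_space.

Section measurability_rV.
Context {R : realType} {n : nat} {d : measure_display} {T : measurableType d}.

Lemma measurable_coord (i : 'I_n) :
  measurable_fun [set: 'rV[R]_n] (fun v : 'rV[R]_n => v 0 i).
Proof.
move=> _ A mA; rewrite setTI; apply: sub_sigma_algebra.
rewrite -bigcup_seq/=; exists i => /=; first by rewrite mem_index_enum.
by exists A => //; rewrite setTI.
Qed.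

(** The coordinates generate the sigma-algebra of row vectors, so its preimage under [f] is
    generated by the coordinates of [f]. *)
Lemma measurable_fun_rVP (f : T -> 'rV[R]_n) :
  measurable_fun setT f <->
  forall i, measurable_fun setT (fun x => f x 0 i).
Proof.
split=> [mf i|mf].
  by apply: (measurableT_comp (measurable_coord i)).
pose coord (i : 'I_n) (v : 'rV[R]_n) : R := v 0 i.
have sub : g_sigma_preimage (fun i => coord i \o f) `<=` measurable.
  apply: smallest_sub; first exact: sigma_algebra_measurable.
  by move=> B; rewrite -bigcup_seq/= => -[i _ [A mA <-]]; exact: mf.
move=> _ A mA; apply: sub; rewrite g_sigma_preimage_comp.
by exists A.
Qed.

Lemma measurable_fun_rVD (f g : T -> 'rV[R]_n) :
  measurable_fun setT f -> measurable_fun setT g ->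
  measurable_fun setT (fun x => f x + g x).
Proof.
move=> /measurable_fun_rVP mf /measurable_fun_rVP mg.
apply/measurable_fun_rVP => i; under eq_fun do rewrite mxE.
exact: measurable_funD.
Qed.

Lemma measurable_fun_rVZ (a : R) (f : T -> 'rV[R]_n) :
  measurable_fun setT f -> measurable_fun setT (fun x => a *: f x).
Proof.
move=> /measurable_fun_rVP mf.
apply/measurable_fun_rVP => i; under eq_fun do rewrite mxE.
exact: measurable_funM.
Qed.

Lemma measurable_fun_rVB (f g : T -> 'rV[R]_n) :
  measurable_fun setT f -> measurable_fun setT g ->
  measurable_fun setT (fun x => f x - g x).
Proof.
move=> mf mg; under eq_fun do rewrite -scaleN1r.
by apply: measurable_fun_rVD => //; exact: measurable_fun_rVZ.
Qed.

Lemma measurable_fun_dotv (f g : T -> 'rV[R]_n) :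
  measurable_fun setT f -> measurable_fun setT g ->
  measurable_fun setT (fun x => dotv (f x) (g x)).
Proof.
move=> /measurable_fun_rVP mf /measurable_fun_rVP mg.
by apply: measurable_sum => i; exact: measurable_funM.
Qed.

Lemma measurable_fun_enorm (f : T -> 'rV[R]_n) :
  measurable_fun setT f -> measurable_fun setT (fun x => enorm (f x)).
Proof.
(* The square root becomes the power 1/2, so that [measurable_powR] applies. *)
move=> mf; rewrite (_ : (fun _ => _) = (fun x => (dotv (f x) (f x)) `^ 2^-1)).
  apply: (measurableT_comp (measurable_powR _)).
  exact: measurable_fun_dotv.
apply/funext => x; rewrite powR12_sqrt; last by rewrite -sqr_enorm sqr_ge0.
by rewrite -sqr_enorm sqrtr_sqr ger0_norm// enorm_ge0.
Qed.

End measurability_rV.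

(** * Total variation and orthogonality by layer-cake approximation *)

Section staircase.
Context {R : realType}.
Implicit Types (h y : R) (N : nat).

(* Approximates the identity on [0, N * h] up to h from below.  After composition
   with f it is a combination of indicators of superlevel sets of f, which
   transfers estimates on measures of sets to integrals of f. *)
Definition stair h N y : R := \sum_(i < N) h * (i.+1%:R * h < y)%R%:R.

(** Above [h] the lowest step is full and the others form a staircase for [y - h]; the inductions on
    [N] below rest on this. *)
Lemma stairS_lt h N y : h < y -> stair h N.+1 y = h + stair h N (y - h).
Proof.
move=> hy; rewrite /stair big_ord_recl; congr (_ + _).
  by rewrite mul1r hy mulr1.
apply: eq_bigr => i _; congr (_ * (_ : bool)%:R).
by rewrite lift0 ltrBrDr -natr1 mulrDl mul1r.
Qed.

Lemma stair_eq0 h N y : 0 < h -> y <= h -> stair h N y = 0.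
Proof.
move=> h0 yh; apply: big1 => i _; case: ltP => [|_]; last by rewrite mulr0.
by move=> /lt_le_trans /(_ yh); rewrite gtr_pMl// ltrn1.
Qed.

Lemma stair_le h N y : 0 < h -> 0 <= y -> stair h N y <= y.
Proof.
move=> h0; elim: N y => [|N IH] y y0; first by rewrite /stair big_ord0.
have [yh|hy] := leP y h; first by rewrite stair_eq0.
by rewrite stairS_lt// -lerBrDl IH// subr_ge0 ltW.
Qed.

Lemma le_stairD h N y : 0 < h -> y <= N%:R * h -> y <= stair h N y + h.
Proof.
move=> h0; elim: N y => [|N IH] y yN.
  move: yN; rewrite /stair big_ord0 mul0r add0r => /le_trans.
  by apply; exact: ltW.
have [yh|hy] := leP y h; first by rewrite stair_eq0// add0r.
rewrite stairS_lt// -addrA -lerBlDl IH// lerBlDr.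
by rewrite -natr1 mulrDl mul1r in yN.
Qed.

End staircase.

Section integral_stair.
Context {d : measure_display} {T : measurableType d} {R : realType}.

Lemma measurable_superlevel (a : R) (f : T -> R) :
  measurable_fun setT f -> measurable [set x | a < f x].
Proof.
by move=> mf; rewrite -[X in measurable X]setTI; exact: measurable_fun_ltr.
Qed.

Lemma indic_superlevel (a : R) (f : T -> R) :
  (fun x => (a < f x)%R%:R) = \1_[set x | a < f x] :> (T -> R).
Proof. by apply/funext => x; rewrite indicE mem_setE. Qed.

Lemma measurable_fun_superlevel (a : R) (f : T -> R) :
  measurable_fun setT f -> measurable_fun setT (fun x => (a < f x)%R%:R : R).
Proof.
move=> mf; rewrite indic_superlevel.
by apply: measurable_indic; exact: measurable_superlevel.
Qed.

Lemma measurable_fun_stair (h : R) N (f : T -> R) :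
  measurable_fun setT f -> measurable_fun setT (fun x => stair h N (f x)).
Proof.
move=> mf; apply: measurable_sum => i; apply: measurable_funM => //.
exact: measurable_fun_superlevel.
Qed.

Lemma integral_stair (m : {measure set T -> \bar R}) (h : R) N (f : T -> R) :
  0 <= h -> measurable_fun setT f ->
  (\int[m]_x (stair h N (f x))%:E =
    \sum_(i < N) h%:E * m [set x | i.+1%:R * h < f x]%R)%E.
Proof.
move=> h0 mf; under eq_integral do rewrite /stair -sumEFin.
rewrite ge0_integral_sum//=; last 2 first.
- move=> i; apply/measurable_EFinP; apply: measurable_funM => //.
  exact: measurable_fun_superlevel.
- by move=> i x _; rewrite lee_fin mulr_ge0.
apply: eq_bigr => i _; under eq_integral do rewrite EFinM.
rewrite ge0_integralZl//=; last first.
  by apply/measurable_EFinP; exact: measurable_fun_superlevel.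
rewrite -[in RHS](setIT [set x | _]) -integral_indic//.
  by congr *%E; apply: eq_integral => x _; rewrite -indic_superlevel.
exact: measurable_superlevel.
Qed.

(** Composed with [f], the staircase is a sum of [N] indicators with weight [h]; changing the
    measure costs [delta] for each, hence [N * h * delta = c * delta] in all. The gap between [f]
    and its staircase is at most [h], its [m1]-integral too because [m1 setT <= 1], and [h] is
    arbitrarily small. *)
Lemma le_integral_close_measures (m1 m2 : {measure set T -> \bar R})
    (f : T -> R) (c delta : R) :
  measurable_fun setT f -> (forall x, 0 <= f x <= c) -> 0 <= delta ->
  (m1 setT <= 1)%E ->
  (forall A, measurable A -> m1 A <= m2 A + delta%:E)%E ->
  (\int[m1]_x (f x)%:E <= \int[m2]_x (f x)%:E + (c * delta)%:E)%E.
Proof.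
move=> mf f0c delta0 m1T m12.
have f0 x : 0 <= f x by case/andP: (f0c x).
have fc x : f x <= c by case/andP: (f0c x).
have c0 : 0 <= c := le_trans (f0 point) (fc point).
move: c0; rewrite le_eqVlt => /predU1P[c0|c0].
  rewrite (eq_integral (cst 0%E)) ?integral0.
    rewrite adde_ge0 ?integral_ge0// ?lee_fin -?c0 ?mul0r// => x _.
    by rewrite lee_fin.
  by move=> x _; congr EFin; apply/eqP; rewrite eq_le f0 andbT c0.
apply/lee_addgt0Pr => e e0.
(* [N * h = c] makes the staircase cover the range of [f], and [N] is large enough for [h <= e]. *)
pose N := (Num.truncn (c / e)).+1; pose h := c / N%:R.
have h0 : 0 < h by rewrite divr_gt0.
have Nh : N%:R * h = c by rewrite mulrC divfK ?pnatr_eq0.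
have he : h <= e.
  rewrite /h ler_pdivrMr// mulrC -ler_pdivrMr//.
  by rewrite ltW// truncnS_gt.
have mA i : measurable [set x | i.+1%:R * h < f x].
  exact: measurable_superlevel.
have ms := measurable_fun_stair h N mf.
have s0 x : 0 <= stair h N (f x).
  by apply: sumr_ge0 => i _; rewrite mulr_ge0// ltW.
have m2s : (\int[m2]_x (stair h N (f x))%:E <= \int[m2]_x (f x)%:E)%E.
  apply: ge0_le_integral => //.
  - by move=> x _; rewrite lee_fin.
  - exact/measurable_EFinP.
  - exact/measurable_EFinP.
  - by move=> x _; rewrite lee_fin stair_le.
have m1s : (\int[m1]_x (f x)%:E <= \int[m1]_x (stair h N (f x))%:E + h%:E)%E.
  apply: (@le_trans _ _ (\int[m1]_x ((stair h N (f x))%:E + h%:E))%E).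
    apply: ge0_le_integral => //.
    - by move=> x _; rewrite lee_fin.
    - exact/measurable_EFinP.
    - by apply/measurable_EFinP; exact: measurable_funD.
    - by move=> x _; rewrite lee_fin le_stairD// Nh.
  rewrite ge0_integralD//.
  - rewrite leeD2l// integral_cst// -[leRHS]mule1 lee_pmul2l//.
  - by move=> x _; rewrite lee_fin.
  - exact/measurable_EFinP.
  - by move=> x _; rewrite lee_fin ltW.
apply: (le_trans m1s); rewrite leeD ?lee_fin//.
apply: (@le_trans _ _
  (\int[m2]_x (stair h N (f x))%:E + (c * delta)%:E)%E); last first.
  by rewrite leeD2r.
rewrite !integral_stair ?(ltW h0)//.
rewrite (_ : (c * delta)%:E = \sum_(i < N) (h * delta)%:E)%E.
  rewrite -big_split/=; apply: lee_sum => i _.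
  rewrite (EFinM h) -ge0_muleDr ?lee_fin// lee_pmul2l ?lte_fin//.
  exact: m12.
by rewrite sumEFin sumr_const card_ord -mulr_natl mulrA Nh.
Qed.

End integral_stair.

(** * Almost everywhere comparison and domination of integrals *)

Section ae_integral.
Context {d : measure_display} {T : measurableType d} {R : realType}.
Variable P : {measure set T -> \bar R}.

(** [g - f] agrees almost everywhere with its positive part, whose integral is nonnegative. *)
Lemma ae_le_Rintegral (f g : T -> R) :
  P.-integrable setT (EFin \o f) -> P.-integrable setT (EFin \o g) ->
  {ae P, forall x, f x <= g x} -> \int[P]_x f x <= \int[P]_x g x.
Proof.
move=> If Ig fg; rewrite -subr_ge0 -RintegralB//.
have Igf := integrableB measurableT Ig If.
have mgf : measurable_fun setT (fun x => g x - f x).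
  by apply/measurable_EFinP; exact: measurable_int Igf.
rewrite /Rintegral (@ae_eq_integral _ _ _ P setT
  (fun x => (Num.max (g x - f x) 0)%:E))//.
- by rewrite fine_ge0// integral_ge0// => x _; rewrite lee_fin le_max lexx orbT.
- exact/measurable_EFinP.
- by apply/measurable_EFinP; exact: measurable_maxr.
- move: fg; apply: filterS => x fg _.
  by congr EFin; apply/esym/max_idPl; rewrite subr_ge0.
Qed.

Lemma integrable_ae_bounded_mul (M : R) (Y W : T -> R) :
  measurable_fun setT Y -> {ae P, forall x, `|Y x| <= M} ->
  P.-integrable setT (EFin \o W) ->
  P.-integrable setT (EFin \o (fun x => Y x * W x)).
Proof.
move=> mY YM IW.
have mW : measurable_fun setT W.
  by apply/measurable_EFinP; exact: measurable_int IW.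
have IM : P.-integrable setT (fun x => (`|M|%:E * (`|W x|%:E))%E).
  apply: integrableZl => //.
  exact: integrable_abse IW.
apply/integrableP; split.
  by apply/measurable_EFinP; exact: measurable_funM.
have /integrableP[mMW] := IM; apply: le_lt_trans.
apply: ae_ge0_le_integral => //.
- apply: measurableT_comp => //.
  by apply/measurable_EFinP; exact: measurable_funM.
- exact: measurableT_comp.
- move: YM; apply: filterS => x YM _; rewrite lee_fin !normrM !normr_id.
  by rewrite ler_wpM2r// (le_trans YM)// ler_norm.
Qed.

End ae_integral.

Section orthogonality.
Context {d : measure_display} {T : measurableType d} {R : realType}.
Variable P : probability T R.

Lemma integrable_ae_bounded (M : R) (Y : T -> R) :
  measurable_fun setT Y -> {ae P, forall x, `|Y x| <= M} ->
  P.-integrable setT (EFin \o Y).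
Proof.
move=> mY YM; have := integrable_ae_bounded_mul mY YM
  (finite_measure_integrable_cst P 1 measurableT).
by under [X in EFin \o X]eq_fun do rewrite mulr1.
Qed.

(** The superlevel sets of [Y] belong to [G], so a staircase approximation of [Y] is a combination
    of indicators orthogonal to [W]. The approximation is uniform and [W] is integrable, so [Y]
    inherits the orthogonality. *)
Lemma Rintegral_mul_eq0 (G : set (set T)) (M : R) (Y W : T -> R) :
  G `<=` measurable -> (forall A, measurable A -> G (Y @^-1` A)) ->
  {ae P, forall x, `|Y x| <= M} -> P.-integrable setT (EFin \o W) ->
  (forall B, G B -> \int[P]_(x in B) (W x)%:E = 0)%E ->
  \int[P]_x (Y x * W x) = 0.
Proof.
move=> Gm GY YM IW W0.
wlog M0 : M YM / 0 < M.
  move=> /(_ (`|M| + 1)); apply; last by rewrite ltr_wpDl.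
  by move: YM; apply: filterS => x /le_trans; apply; rewrite ler_wpDr// ler_norm.
have mY : measurable_fun setT Y.
  by move=> _ A mA; rewrite setTI; exact/Gm/GY.
have GT : G setT by rewrite -(preimage_setT Y); exact: GY.
(* The shift moves [Y] into [[0, M + M]], where the staircase approximates; the integral against [W]
   is unchanged because [W] has mean 0. *)
pose Y' x := Y x + M.
have mY' : measurable_fun setT Y' by exact: measurable_funD.
have Y'M : {ae P, forall x, 0 <= Y' x <= M + M}.
  move: YM; apply: filterS => x; rewrite ler_norml => /andP[? ?].
  by rewrite /Y' -lerBlDr sub0r lerD2r; apply/andP.
have IYW := integrable_ae_bounded_mul mY YM IW.
have Y'b : {ae P, forall x, `|Y' x| <= M + M}.
  by move: Y'M; apply: filterS => x /andP[? ?]; rewrite ger0_norm.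
have IY'W := integrable_ae_bounded_mul mY' Y'b IW.
have W0R : \int[P]_x W x = 0 by rewrite /Rintegral W0.
have -> : \int[P]_x (Y x * W x) = \int[P]_x (Y' x * W x).
  under [RHS]eq_Rintegral do rewrite mulrDl.
  rewrite RintegralD ?RintegralZl ?W0R ?mulr0 ?addr0//.
  exact: (integrableZl measurableT M IW).
pose w := \int[P]_x `|W x|.
have IaW : P.-integrable setT (EFin \o (fun x => `|W x|)) := integrable_abse IW.
have w0 : 0 <= w by exact: Rintegral_ge0.
have key h N : 0 < h -> N%:R * h = M + M -> `|\int[P]_x (Y' x * W x)| <= h * w.
  move=> h0 Nh.
  have mA i : G [set x | i.+1%:R * h < Y' x].
    rewrite (_ : [set x | _] = Y @^-1` [set y | i.+1%:R * h < y + M])//.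
    by apply: GY; apply: measurable_superlevel; exact: measurable_funD.
  pose V (i : nat) x := \1_[set x | i.+1%:R * h < Y' x] x * W x.
  have IV i : P.-integrable setT (EFin \o V i).
    apply: (@integrable_ae_bounded_mul _ _ _ _ 1) => //.
      by apply: measurable_indic; exact/Gm/mA.
    by apply: aeW => x; rewrite indicE; case: (_ \in _); rewrite ?normr1 ?normr0.
  have EsW x : stair h N (Y' x) * W x =
      \sum_(i < N) h * V i x.
    rewrite mulr_suml; apply: eq_bigr => i _.
    by rewrite /V indicE mem_setE mulrA.
  have IsW : P.-integrable setT (EFin \o (fun x => stair h N (Y' x) * W x)).
    rewrite (_ : _ \o _ = (fun x => \sum_(i < N) (h * V i x)%:E)%E).
      by apply: integrable_sum => // i _; exact: (integrableZl measurableT h (IV i)).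
    by apply/funext => x /=; rewrite EsW sumEFin.
  have -> : \int[P]_x (Y' x * W x) =
      \int[P]_x (Y' x * W x - stair h N (Y' x) * W x).
    rewrite RintegralB// [X in _ - X](_ : _ = 0) ?subr0//.
    rewrite /Rintegral; under eq_integral do rewrite EsW -sumEFin.
    rewrite integral_sum//; last first.
      by move=> i; exact: (integrableZl measurableT h (IV i)).
    rewrite big1// => i _; under eq_integral do rewrite EFinM.
    rewrite integralZl//; last exact: IV.
    rewrite [X in (_ * X)%E](_ : _ = 0%E) ?mule0//.
    rewrite -[RHS](W0 _ (mA i)) [RHS]integral_mkcond.
    apply: eq_integral => x _; rewrite patchE /V indicE.
    by case: ifPn; rewrite ?mul1r ?mul0r.
  have bd : {ae P, forall x,
      `|Y' x * W x - stair h N (Y' x) * W x| <= h * `|W x|}.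
    move: Y'M; apply: filterS => x /andP[Y0 YM2].
    rewrite -mulrBl normrM ler_wpM2r// ger0_norm ?subr_ge0 ?stair_le//.
    by rewrite lerBlDl le_stairD// Nh.
  have Id := integrableB measurableT IY'W IsW.
  rewrite (le_trans (le_normr_Rintegral _ Id))// /w -RintegralZl//.
  apply: ae_le_Rintegral => //.
    exact: integrable_abse Id.
  exact: (integrableZl measurableT h IaW).
apply/eqP; rewrite -normr_le0; apply/ler_addgt0Pr => e e0; rewrite add0r.
(* Large enough for the step height [(M + M) / N] times [w] to be at most [e]. *)
pose N := (Num.truncn ((M + M) * (w + 1) / e)).+1.
apply: (le_trans (key ((M + M) / N%:R) N _ _)).
- by rewrite divr_gt0// addr_gt0.
- by rewrite mulrC divfK ?pnatr_eq0.
- rewrite mulrAC ler_pdivrMr// mulrC (mulrC e) -ler_pdivrMr//.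
  rewrite (le_trans _ (ltW (truncnS_gt _)))//.
  rewrite ler_pM2r ?invr_gt0// mulrC ler_pM2l ?addr_gt0//.
  by rewrite lerDl.
Qed.

End orthogonality.

(** * Disintegration and the Markov property *)

Section disintegration.
Context {d d1 d2 : measure_display} {Omega : measurableType d}
  {U : measurableType d1} {S : measurableType d2} {R : realType}.
Variables (P : probability Omega R) (Z : {mfun Omega >-> U})
  (Y : {mfun Omega >-> S}) (kappa : R.-spker U ~> S).

Let section_pair (u : U) (s : S) : U * S := (u, s).

(* Product of the Dirac mass at [Z om] with [kappa (Z om)]; the dummy factor [unit]
   is there to apply [integral_kcomp]. *)
Let graph_kernel (x : unit * Omega) : set (U * S) -> \bar R :=
  pushforward (kappa (Z x.2)) (section_pair (Z x.2)).

Let graph_kernelE x E : graph_kernel x E = kappa (Z x.2) (xsection E (Z x.2)).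
Proof. by rewrite xsectionE. Qed.

Let graph_kernel0 x : graph_kernel x set0 = 0%E.
Proof. by rewrite graph_kernelE xsection0 measure0. Qed.

Let graph_kernel_ge0 x E : (0 <= graph_kernel x E)%E.
Proof. by rewrite graph_kernelE; exact: measure_ge0. Qed.

Let graph_kernel_sigma_additive x : semi_sigma_additive (graph_kernel x).
Proof.
move=> E mE tE mUE; under eq_fun do under eq_bigr do rewrite graph_kernelE.
rewrite graph_kernelE xsection_bigcup.
apply: measure_semi_sigma_additive => [i| |].
- exact: measurable_xsection.
- exact: trivIset_xsection.
- by rewrite -xsection_bigcup; exact: measurable_xsection.
Qed.

HB.instance Definition _ x := isMeasure.Build _ _ _ (graph_kernel x)
  (graph_kernel0 x) (graph_kernel_ge0 x) (@graph_kernel_sigma_additive x).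

Let graph_measure := graph_kernel : _ -> {measure set (U * S) -> \bar R}.

Let measurable_graph_kernel E :
  measurable E -> measurable_fun setT (graph_measure ^~ E).
Proof.
move=> mE; apply: (eq_measurable_fun
  (fun x : unit * Omega => kappa (Z x.2) (xsection E (Z x.2)))).
  by move=> x _; rewrite -graph_kernelE.
have mk := @measurable_fun_xsection_finite_kernel _ _ _ _ _ kappa E (mem_set mE).
apply: (measurableT_comp mk); exact: measurableT_comp.
Qed.

HB.instance Definition _ := isKernel.Build _ _ _ _ _ graph_measure
  measurable_graph_kernel.

Let graph_kernel_uub : measure_fam_uub graph_measure.
Proof.
exists 2 => x; rewrite [X in (X < _)%E]graph_kernelE.
rewrite (@le_lt_trans _ _ 1%E) ?lte1n//.
by rewrite xsectionE preimage_setT sprob_kernel_le1.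
Qed.

HB.instance Definition _ := Kernel_isFinite.Build _ _ _ _ _ graph_measure
  graph_kernel_uub.

Let base : R.-sfker unit ~> Omega :=
  kprobability (measurable_cst (P : pprobability Omega R)).

(** By hypothesis the law of [(Z, Y)] and the composition of [P] with [graph_kernel] agree on
    rectangles, a pi-system generating the product sigma-algebra; hence the two measures are equal,
    and so are their integrals. *)
Lemma ge0_integral_disintegration :
  (forall A B, measurable A -> measurable B ->
    P (Z @^-1` A `&` Y @^-1` B) = \int[P]_(om in Z @^-1` A) kappa (Z om) B)%E ->
  forall h : U * S -> \bar R, measurable_fun setT h -> (forall z, 0 <= h z)%E ->
    (\int[P]_om h (Z om, Y om) = \int[P]_om \int[kappa (Z om)]_s h (Z om, s))%E.
Proof.
move=> PZY h mh h0.
have mZY : measurable_fun setT (fun om => (Z om, Y om)).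
  exact: measurable_fun_pair.
pose ZY : {mfun Omega >-> (U * S)%type} :=
  HB.pack (fun om => (Z om, Y om)) (isMeasurableFun.Build _ _ _ _ _ mZY).
transitivity (\int[pushforward P ZY]_z h z)%E.
  by rewrite ge0_integral_pushforward.
transitivity (\int[kcomp base graph_measure tt]_z h z)%E; last first.
  rewrite integral_kcomp//; apply: eq_integral => om _.
  by rewrite ge0_integral_pushforward//; exact: measurable_fun_pair.
apply: eq_measure_integral => E mE _.
pose C := [set A `*` B | A in @measurable _ U & B in @measurable _ S].
apply: (measure_unique C (fun=> setT)) => //.
- exact: measurable_prod_measurableType.
- move=> _ _ [A1 mA1 [B1 mB1 <-]] [A2 mA2 [B2 mB2 <-]].
  exists (A1 `&` A2); first exact: measurableI.
  by exists (B1 `&` B2); [exact: measurableI|rewrite setXI].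
- by move=> _; exists setT => //; exists setT => //; rewrite setXTT.
- by rewrite bigcup_const.
- move=> _ [A mA [B mB <-]].
  transitivity (P (Z @^-1` A `&` Y @^-1` B)) => //; rewrite PZY//.
  rewrite integral_mkcond; apply: eq_integral => om _.
  rewrite [RHS]graph_kernelE patchE/=; case: ifPn => [/set_mem ZA|ZA].
    by rewrite in_xsectionX// mem_set.
  by rewrite notin_xsectionX ?measure0.
- move=> _; apply: (le_lt_trans _ (ltry 1)).
  by rewrite -(probability_setT P); exact: lexx.
Qed.

End disintegration.

Section markov_property.
Context {d d1 : measure_display} {Omega : measurableType d}
  {S : measurableType d1} {R : realType}.

(** The sets whose preimage lies in [H] form a sigma-algebra, and it contains the rectangles. *)
Lemma preimage_pair_sigma_algebra d2 (T : measurableType d2) (H : set (set Omega))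
    (f : Omega -> T) (g : Omega -> S) :
  sigma_algebra setT H ->
  (forall A, measurable A -> H (f @^-1` A)) ->
  (forall A, measurable A -> H (g @^-1` A)) ->
  forall A, measurable A -> H ((fun om => (f om, g om)) @^-1` A).
Proof.
move=> sH Hf Hg A; rewrite measurable_prod_measurableType => mA.
suff sub : [set B `*` C | B in @measurable _ T & C in @measurable _ S] `<=`
    image_set_system setT (fun om => (f om, g om)) H.
  have := smallest_sub (sigma_algebra_image _ sH) sub mA.
  by rewrite /image_set_system/= setTI.
move=> _ [B mB [C mC <-]]; rewrite /image_set_system/=.
rewrite setTI (_ : _ @^-1` _ = f @^-1` B `&` g @^-1` C)//.
have [_ _ _ HI] := (sigma_algebraP (fun C _ => @subsetT _ C)).1 sH.
by apply: HI; [exact: Hf|exact: Hg].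
Qed.

Variables (P : probability Omega R) (G : nat -> set (set Omega))
  (K : R.-pker S ~> S) (X : nat -> {RV P >-> S}).
Hypotheses (sG : forall m, sigma_algebra setT (G m))
  (Gm : forall m, G m `<=` measurable) (GS : forall m, G m `<=` G m.+1)
  (GX : forall m A, measurable A -> G m (X m @^-1` A))
  (markovX : markov_chain P G K X).

(* Conditioned on the formula for [kpow K t], so that it can be used inside the
   induction on [t] that proves this formula. *)
Let ge0_integral_markov_aux t m :
  (forall A B, measurable A -> G m B ->
    P (B `&` X (m + t)%N @^-1` A) = \int[P]_(om in B) kpow K t (X m om) A)%E ->
  forall d2 (T : measurableType d2) (a : Omega -> T) (h : T * S -> \bar R),
  (forall A, measurable A -> G m (a @^-1` A)) ->
  measurable_fun setT h -> (forall z, 0 <= h z)%E ->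
  (\int[P]_om h (a om, X (m + t)%N om) =
   \int[P]_om \int[kpow K t (X m om)]_x h (a om, x))%E.
Proof.
move=> kpowE d2 T a h Ga mh h0.
have ma : measurable_fun setT a by move=> _ A mA; rewrite setTI; exact/Gm/Ga.
have mZ : measurable_fun setT (fun om => (a om, X m om)).
  exact: measurable_fun_pair.
(* The kernel reads only the second component of [(a, X m)], so disintegrating along this pair
   averages over [X (m + t)] with [a] held fixed. *)
pose Z : {mfun Omega >-> (T * S)%type} :=
  HB.pack (fun om => (a om, X m om)) (isMeasurableFun.Build _ _ _ _ _ mZ).
pose g (z : (T * S) * S) := h (z.1.1, z.2).
have mg : measurable_fun setT g.
  apply: (measurableT_comp mh); apply: measurable_fun_pair => //.
  by apply: measurableT_comp => //; exact: measurableT_comp.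
have := @ge0_integral_disintegration _ _ _ _ _ _ _ P Z (X (m + t)%N)
  (kernel.kernel_snd (kpow K t)) _ g mg (fun z => h0 _).
apply => A B mA mB; apply: kpowE => //.
exact: (preimage_pair_sigma_algebra (sG m) Ga (@GX m) mA).
Qed.

(** Chapman-Kolmogorov: the one-step property at time [m + t] leaves the integral of
    [K (X (m + t)) A] over [B], to which the induction hypothesis applies. *)
Lemma markov_chain_kpow t m A B : measurable A -> G m B ->
  P (B `&` X (m + t)%N @^-1` A) = (\int[P]_(om in B) kpow K t (X m om) A)%E.
Proof.
elim: t A B => [|t IH] A B mA GB.
  rewrite addn0 /= setIC -integral_indic//; last first.
  - by rewrite -[X in measurable X]setTI; exact: measurable_funP.
  - exact: Gm GB.
have GmS t' : G m `<=` G (m + t')%N.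
  by elim: t' => [|t' IHt]; rewrite ?addn0// addnS => C /IHt; exact: GS.
rewrite addnS markovX//; last exact: GmS GB.
have mB := Gm GB.
(* [B] enters through its indicator, which is known at time [m]. The absolute value makes [h]
   nonnegative everywhere and preserves the values 0 and 1. *)
pose h (z : R * S) := (`|z.1|%:E * K z.2 A)%E.
have mh : measurable_fun setT h.
  apply: emeasurable_funM.
    by apply/measurable_EFinP; exact: measurableT_comp.
  exact: measurableT_comp (measurable_kernel K _ mA) _.
have GB1 (C : set (measurableTypeR R)) : measurable C -> G m (\1_B @^-1` C).
  move=> _; have [G0 GC _] := sG m; rewrite preimage_indic.
  have GT : G m setT by rewrite -(setD0 setT); exact: GC.
  by case: ifPn => _; case: ifPn => _ //; rewrite -setTD//; exact: GC.
have {}IH := ge0_integral_markov_aux IH GB1 mh.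
rewrite integral_mkcond (eq_integral (fun om => h (\1_B om, X (m + t)%N om))).
  rewrite IH; last by move=> z; rewrite mule_ge0// lee_fin.
  rewrite [RHS]integral_mkcond; apply: eq_integral => om _.
  rewrite patchE/h indicE/=; case: ifPn => omB.
    by under eq_integral do rewrite normr1 mul1e.
  by rewrite integral0_eq// => x _; rewrite normr0 mul0e.
move=> om _; rewrite patchE/h indicE/=; case: ifPn => omB.
  by rewrite normr1 mul1e.
by rewrite normr0 mul0e.
Qed.

(** Serves with [a := theta m]: the chain is averaged while the iterate stays frozen. *)
Lemma ge0_integral_markov t m d2 (T : measurableType d2) (a : Omega -> T)
    (h : T * S -> \bar R) :
  (forall A, measurable A -> G m (a @^-1` A)) ->
  measurable_fun setT h -> (forall z, 0 <= h z)%E ->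
  (\int[P]_om h (a om, X (m + t)%N om) =
   \int[P]_om \int[kpow K t (X m om)]_x h (a om, x))%E.
Proof. by apply: ge0_integral_markov_aux; exact: markov_chain_kpow. Qed.

End markov_property.

(** * The mean field *)

Section mean_field.
Context {d : measure_display} {S : measurableType d} {R : realType} {n : nat}.
Variables (mu : probability S R).

Lemma Rintegral_dotv (c : R) (f : S -> 'rV[R]_n) (u : 'rV[R]_n) :
  measurable_fun setT f -> (forall x, enorm (f x) <= c) ->
  \int[mu]_x dotv u (f x) = dotv u (\row_j \int[mu]_x f x 0 j).
Proof.
move=> mf fc.
have If j : mu.-integrable setT (EFin \o (fun x => f x 0 j)).
  apply: (@integrable_ae_bounded _ _ _ _ c); first by move/measurable_fun_rVP : mf.
  by apply: aeW => x; exact: le_trans (normr_coord_enorm _ _) (fc x).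
have IfE j : (\int[mu]_x (f x 0%R j)%:E)%E = (\int[mu]_x f x 0 j)%:E.
  by rewrite fineK//; exact: (integrable_fin_num measurableT (If j)).
rewrite {1}/Rintegral; under eq_integral do rewrite -sumEFin.
rewrite integral_sum//; last first.
  by move=> j; exact: (integrableZl measurableT (u 0 j) (If j)).
under eq_bigr => j _.
  under eq_integral do rewrite EFinM.
  rewrite integralZl//; last exact: If.
  rewrite IfE -EFinM.
  over.
by rewrite sumEFin; apply: eq_bigr => j _; rewrite mxE.
Qed.

(** With [v] the vector of integrals, [enorm v ^+ 2] is the integral of [dotv v (f x)], hence at
    most [enorm v * c]. *)
Lemma enorm_Rintegral_le (c : R) (f : S -> 'rV[R]_n) :
  measurable_fun setT f -> (forall x, enorm (f x) <= c) ->
  enorm (\row_j \int[mu]_x f x 0 j) <= c.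
Proof.
move=> mf fc; set v := \row_j _.
have c0 : 0 <= c := le_trans (enorm_ge0 _) (fc point).
have [->//|v0] := eqVneq (enorm v) 0.
have {}v0 : 0 < enorm v by rewrite lt_def v0 enorm_ge0.
rewrite -(ler_pM2l v0) -expr2 sqr_enorm -(Rintegral_dotv _ mf fc).
have Idot : mu.-integrable setT (EFin \o (fun x => dotv v (f x))).
  apply: (@integrable_ae_bounded _ _ _ _ (enorm v * c)).
    exact: measurable_fun_dotv.
  apply: aeW => x; rewrite (le_trans (normr_dotv _ _))//.
  by rewrite ler_wpM2l// enorm_ge0.
have -> : enorm v * c = \int[mu]_x (enorm v * c).
  by rewrite Rintegral_cst// [X in fine X]probability_setT mulr1.
apply: le_Rintegral => // [|x _].
  exact: finite_measure_integrable_cst.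
by rewrite (le_trans (dotv_enorm _ _))// ler_wpM2l// enorm_ge0.
Qed.

Variables (F : S -> 'rV[R]_n -> 'rV[R]_n) (L1 : R).
Hypotheses (mF : measurable_fun [set: S * 'rV[R]_n]
    (fun z : S * 'rV[R]_n => F z.1 z.2))
  (lipF : lipschitz_operator F L1).

Lemma measurable_operator theta : measurable_fun setT (F ^~ theta).
Proof. exact: (measurable_fun_pair1 theta mF). Qed.

Lemma enorm_operator_le x theta : enorm (F x theta) <= L1 * (enorm theta + 1).
Proof.
have [_ lip F0] := lipF.
rewrite -(subrK (F x 0) (F x theta)) (le_trans (ler_enormD _ _))//.
by rewrite mulrDr mulr1 lerD// (le_trans (lip _ _ _))// subr0.
Qed.

Lemma dotv_mean_field u theta :
  dotv u (mean_field F mu theta) = \int[mu]_x dotv u (F x theta).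
Proof.
by rewrite (@Rintegral_dotv (L1 * (enorm theta + 1)))//;
  [exact: measurable_operator|move=> x; exact: enorm_operator_le].
Qed.

Lemma enorm_mean_field_le theta :
  enorm (mean_field F mu theta) <= L1 * (enorm theta + 1).
Proof.
apply: enorm_Rintegral_le; first exact: measurable_operator.
by move=> x; exact: enorm_operator_le.
Qed.

Lemma mean_field_lipschitz theta1 theta2 :
  enorm (mean_field F mu theta1 - mean_field F mu theta2) <=
  L1 * enorm (theta1 - theta2).
Proof.
have [_ lip _] := lipF.
have Icoord theta j : mu.-integrable setT (EFin \o (fun x => F x theta 0 j)).
  apply: (@integrable_ae_bounded _ _ _ _ (L1 * (enorm theta + 1))).
    by apply: (measurable_fun_rVP _).1; exact: measurable_operator.
  apply: aeW => x; apply: le_trans (normr_coord_enorm _ _) _.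
  exact: enorm_operator_le.
rewrite (_ : _ - _ = \row_j \int[mu]_x (F x theta1 - F x theta2) 0 j).
  apply: enorm_Rintegral_le => [|x]; last exact: lip.
  by apply: measurable_fun_rVB; exact: measurable_operator.
apply/rowP => j; rewrite !mxE -RintegralB//.
by apply: eq_Rintegral => x _; rewrite !mxE.
Qed.

Lemma measurable_mean_field : measurable_fun setT (mean_field F mu).
Proof.
apply/measurable_fun_rVP => j; under eq_fun do rewrite mxE.
have mFj : measurable_fun [set: S * 'rV[R]_n]
    (fun z : S * 'rV[R]_n => (F z.1 z.2 0 j)%:E).
  by apply/measurable_EFinP; exact: (measurable_fun_rVP _).1.
rewrite /Rintegral; apply: measurableT_comp; first exact: fine_measurable.
(* After splitting into positive and negative parts, Tonelli gives the measurability in [theta] of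
   each partial integral. *)
under eq_fun do rewrite integralE.
apply: emeasurable_funB.
- rewrite [X in measurable_fun _ X](_ : _ = fubini_G mu
      (fun z : S * 'rV[R]_n => (F z.1 z.2 0 j)%:E)^\+%E).
    exact: (measurable_fun_fubini_tonelli_G _ (measurable_funepos mFj)).
  by apply/funext => theta; apply: eq_integral => x _; rewrite !funeposE.
- rewrite [X in measurable_fun _ X](_ : _ = fubini_G mu
      (fun z : S * 'rV[R]_n => (F z.1 z.2 0 j)%:E)^\-%E).
    exact: (measurable_fun_fubini_tonelli_G _ (measurable_funeneg mFj)).
  by apply/funext => theta; apply: eq_integral => x _; rewrite !funenegE.
Qed.

(** Dissipativity and the Lipschitz bound are compared at [thetas] plus a basis vector, which exists
    since [0 < n]. The comparison turns the step-size condition into bounds on [alpha * L * t] and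
    [c0 * alpha]. *)
Lemma dissipative_le_lipschitz (thetas : 'rV[R]_n) (c0 : R) :
  (0 < n)%N -> dissipative F mu thetas c0 -> c0 <= L1.
Proof.
move=> n_gt0 [F0 _ c0_gt0 diss].
pose v : 'rV[R]_n := delta_mx 0 (Ordinal n_gt0).
have v0 : 0 < enorm v ^+ 2.
  rewrite lt_def sqr_ge0 andbT sqrf_eq0; apply/eqP => /enorm0_eq0 /rowP.
  by move=> /(_ (Ordinal n_gt0)) /eqP; rewrite !mxE !eqxx oner_eq0.
have := diss (v + thetas); have := mean_field_lipschitz (v + thetas) thetas.
have := normr_dotv v (mean_field F mu (v + thetas)).
rewrite F0 subr0 addrK ler_norml => /andP[lb _] lip diss_v.
rewrite -(ler_pM2r v0).
have := ler_wpM2l (enorm_ge0 v) lip; rewrite mulrCA -expr2.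
by move: lb diss_v; lra.
Qed.

End mean_field.

(** * Pathwise one-step estimate *)

Section one_step.
Context {R : realType} {n : nat}.
Implicit Types (th a ts v w : 'rV[R]_n) (p q L alpha : R).

(** While [2 * (x * i) <= 1] the displacement stays below [enorm (th m) + 1], so [enorm (th j) + 1]
    at most doubles over the window and each step adds at most [2 * x * (enorm (th m) + 1)]. Growth
    is thus linear in [i] rather than exponential. *)
Lemma enorm_displacement_le (th : nat -> 'rV[R]_n) (x : R) m i :
  0 <= x -> 2 * (x * i%:R) <= 1 ->
  (forall j, (m <= j)%N -> enorm (th j.+1 - th j) <= x * (enorm (th j) + 1)) ->
  enorm (th (m + i)%N - th m) <= 2 * (x * i%:R) * (enorm (th m) + 1).
Proof.
move=> x0 + step; elim: i => [|i IH] xi.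
  by rewrite addn0 subrr enorm0 !mulr0 mul0r.
have {}xi : 2 * (x * i%:R) + 2 * x <= 1 by move: xi; rewrite -natr1; lra.
have xi1 : 2 * (x * i%:R) <= 1 by lra.
have {}IH := IH xi1.
have := step (m + i)%N (leq_addr _ _); rewrite -addnS => stepi.
have tri := ler_enorm_triangle (th (m + i.+1)%N) (th (m + i)%N) (th m).
have := ler_enormD (th (m + i)%N - th m) (th m); rewrite subrK => grow.
have N0 := enorm_ge0 (th m).
have slack : 0 <= (1 - 2 * (x * i%:R)) * (enorm (th m) + 1).
  by apply: mulr_ge0; lra.
have double : 0 <= x * (2 * (enorm (th m) + 1) - (enorm (th (m + i)%N) + 1)).
  by apply: mulr_ge0 => //; lra.
by rewrite -natr1; lra.
Qed.

Lemma sqr_enormDZ v w alpha :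
  enorm (v + alpha *: w) ^+ 2 =
  enorm v ^+ 2 + 2 * alpha * dotv v w + alpha ^+ 2 * enorm w ^+ 2.
Proof.
by rewrite !sqr_enorm !(dotvDl, dotvDr, dotvZl, dotvZr) (dotvC w v); ring.
Qed.

(** The triangle inequality replaces [enorm a] by [enorm th + enorm (th - a)], and the extra term is
    absorbed on the left: [2 / (1 - 2 / 130) <= 21 / 10]. *)
Lemma near_iterate_le th a p :
  0 <= p <= 130^-1 -> enorm (th - a) <= 2 * p * (enorm a + 1) ->
  enorm (th - a) <= 21 / 10 * p * (enorm th + 1).
Proof.
move=> p130 E_le.
have := ler_enormD (a - th) th; rewrite subrK (enormB a th) => tri.
have E0 := enorm_ge0 (th - a); have N0 := enorm_ge0 th.
have pE : 0 <= (130^-1 - p) * enorm (th - a) by apply: mulr_ge0 => //; lra.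
nra.
Qed.

(** [enorm th + 1] is at most [enorm (th - ts) + (enorm ts + 1)], and passing from [th] to [a] adds
    at most a fraction [21 / 1300 <= 2 / 100] of it. *)
Lemma near_iterate_distance_le th a ts p :
  0 <= p <= 130^-1 -> enorm (th - a) <= 2 * p * (enorm a + 1) ->
  enorm (a - ts) <= 102 / 100 * (enorm (th - ts) + (enorm ts + 1)) /\
  enorm a + 1 <= 102 / 100 * (enorm (th - ts) + (enorm ts + 1)).
Proof.
move=> p130 /(near_iterate_le p130) E_le.
have := ler_enormD (th - ts) ts; rewrite subrK => thq.
have tri := ler_enorm_triangle a th ts.
have := ler_enormD (a - th) th; rewrite subrK => tri'.
move: tri tri'; rewrite (enormB a th) => tri tri'.
have N0 := enorm_ge0 th; have D0 := enorm_ge0 (th - ts).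
have s0 := enorm_ge0 ts.
have pN : 0 <= (130^-1 - p) * (enorm th + 1) by apply: mulr_ge0; lra.
by split; lra.
Qed.

Lemma one_step_le th a ts Fk Fa bk ba w L alpha p c0 :
  0 <= alpha -> 1 <= L -> alpha * L <= p -> 0 <= p <= 130^-1 ->
  enorm (th - a) <= 2 * p * (enorm a + 1) ->
  enorm Fk <= L * (enorm th + 1) -> enorm bk <= L * (enorm th + 1) ->
  enorm (Fk - Fa) <= L * enorm (th - a) ->
  enorm (bk - ba) <= L * enorm (th - a) ->
  enorm (Fk + w) <= L * (enorm th + 1) ->
  dotv (th - ts) bk <= - c0 * enorm (th - ts) ^+ 2 ->
  enorm (th + alpha *: (Fk + w) - ts) ^+ 2 <=
    (1 - 2 * (c0 * alpha)) * enorm (th - ts) ^+ 2 +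
    2 * alpha * dotv (th - ts) w + 2 * alpha * dotv (a - ts) (Fa - ba) +
    36 * (alpha * p * L) * (enorm (th - ts) ^+ 2 + (enorm ts + 1) ^+ 2).
Proof.
move=> alpha0 L1 aL p130 near Fk_le bk_le Fka bka Fw diss.
have [Ar_le _] := near_iterate_distance_le ts p130 near.
have E_le := near_iterate_le p130 near.
have := ler_enormD (th - ts) ts; rewrite subrK => thq.
have D0 := enorm_ge0 (th - ts); have s0 := enorm_ge0 ts; have N0 := enorm_ge0 th.
have Ar0 := enorm_ge0 (a - ts); have E0 := enorm_ge0 (th - a).
set D := enorm (th - ts) in diss thq Ar_le D0 *.
set q := D + (enorm ts + 1) in Ar_le.
set E := enorm (th - a) in near E_le Fka bka E0.
set N := enorm th + 1 in E_le Fk_le bk_le Fw.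
have N_ge0 : 0 <= N by rewrite /N; lra.
have Nq : N <= q by rewrite /N /q; lra.
have q0 : 0 <= q by rewrite /q; lra.
have p0 : 0 <= p by case/andP: p130.
have L0 : 0 <= L by lra.
have pN : p * N <= p * q by rewrite ler_wpM2l.
have Eq : E <= 21 / 10 * (p * q) by lra.
have LNq : L * N <= L * q by rewrite ler_wpM2l.
have ELN : E * (L * N) <= 21 / 10 * (p * q) * (L * q).
  by apply: ler_pM => //; exact: mulr_ge0.
have ArLE : enorm (a - ts) * (L * E) <=
    102 / 100 * q * (L * (21 / 10 * (p * q))).
  by apply: ler_pM => //; [exact: mulr_ge0|rewrite ler_wpM2l].
have d1 : dotv (th - a) Fk <= E * (L * N).
  by rewrite (le_trans (dotv_enorm _ _))// ler_wpM2l.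
have d2 : - dotv (th - a) bk <= E * (L * N).
  rewrite -dotvNr (le_trans (dotv_enorm _ _))// enormN ler_wpM2l//.
have d3 : dotv (a - ts) (Fk - Fa) <= enorm (a - ts) * (L * E).
  by rewrite (le_trans (dotv_enorm _ _))// ler_wpM2l.
have d4 : dotv (a - ts) (ba - bk) <= enorm (a - ts) * (L * E).
  by rewrite (le_trans (dotv_enorm _ _))// (enormB ba) ler_wpM2l.
(* The first term is the contracting drift and the one with [Fa - ba] is kept; each of the other
   four contains a difference of order [E]. *)
have split_dot : dotv (th - ts) Fk = dotv (th - ts) bk + dotv (th - a) Fk -
    dotv (th - a) bk + dotv (a - ts) (Fk - Fa) + dotv (a - ts) (Fa - ba) +
    dotv (a - ts) (ba - bk).
  by rewrite !(dotvDl, dotvDr, dotvNl, dotvNr); ring.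
have pLq : 0 <= p * L * q ^+ 2 by rewrite !mulr_ge0 ?sqr_ge0.
(* The four errors add up to [2 * (21 / 10) + 2 * (102 / 100) * (21 / 10) <= 17 / 2]. *)
have drift : dotv (th - ts) Fk <=
    - c0 * D ^+ 2 + dotv (a - ts) (Fa - ba) + 17 / 2 * (p * L * q ^+ 2).
  by rewrite split_dot; move: ELN ArLE d1 d2 d3 d4 diss pLq; lra.
have Fw2 : enorm (Fk + w) ^+ 2 <= (L * q) ^+ 2.
  by rewrite ler_pXn2r ?nnegrE ?enorm_ge0 ?mulr_ge0//; exact: le_trans Fw LNq.
have step2 : alpha ^+ 2 * enorm (Fk + w) ^+ 2 <= alpha * (p * L * q ^+ 2).
  apply: (@le_trans _ _ (alpha ^+ 2 * (L * q) ^+ 2)).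
    by rewrite ler_wpM2l// sqr_ge0.
  have -> : alpha ^+ 2 * (L * q) ^+ 2 = alpha * ((alpha * L) * L * q ^+ 2).
    by ring.
  by rewrite ler_wpM2l// ler_wpM2r ?sqr_ge0// ler_wpM2r.
have expand : enorm (th + alpha *: (Fk + w) - ts) ^+ 2 =
    D ^+ 2 + 2 * alpha * (dotv (th - ts) Fk + dotv (th - ts) w) +
    alpha ^+ 2 * enorm (Fk + w) ^+ 2.
  by rewrite addrAC sqr_enormDZ dotvDr.
have adrift := ler_wpM2l alpha0 drift.
(* The drift errors give [2 * (17 / 2)] and [step2] gives 1; the factor 2 here turns the total 18
   into 36. *)
have q2 : q ^+ 2 <= 2 * (D ^+ 2 + (enorm ts + 1) ^+ 2).
  by have := sqr_ge0 (D - (enorm ts + 1)); rewrite /q; lra.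
have apL : 0 <= alpha * p * L by rewrite !mulr_ge0.
have := ler_wpM2l apL q2.
rewrite expand; move: adrift step2; lra.
Qed.

End one_step.

(** * Distance to stationarity at the mixing time *)

Section mixing.
Context {d : measure_display} {S : measurableType d} {R : realType}.
Variables (K : R.-pker S ~> S) (mu : probability S R).

(** Geometric decay provides a time at distance at most [delta], hence a least one, so [xget] does
    not return its default. *)
Lemma mixing_dist_mixing_time (delta : R) : 0 < delta ->
  uniformly_geometrically_ergodic K mu ->
  (mixing_dist K mu (mixing_time K mu delta) <= delta%:E)%E.
Proof.
move=> delta0 [_ _ [C [rho [C1 /andP[rho0 rho1] geo]]]].
have [k kP] : exists k, (mixing_dist K mu k <= delta%:E)%E.
  have Cd : 0 < delta / C by rewrite divr_gt0// (lt_le_trans ltr01).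
  have : rho ^+ k @[k --> \oo] --> 0 by apply: cvg_expr; rewrite gtr0_norm.
  move=> /cvgrPdist_lt /(_ _ Cd)[k _ /(_ k (leqnn k))].
  rewrite /= sub0r normrN ger0_norm ?exprn_ge0 ?(ltW rho0)// => rhok.
  exists k; apply: (le_trans (geo k)); rewrite lee_fin mulrC -ler_pdivlMr.
    exact: ltW.
  exact: lt_le_trans C1.
have : exists k, `[< (mixing_dist K mu k <= delta%:E)%E >].
  by exists k; exact/asboolP.
move=> /ex_minnP[t /asboolP tP tmin].
suff [] : [set k | (mixing_dist K mu k <= delta%:E)%E /\
    forall j, (mixing_dist K mu j <= delta%:E)%E -> (k <= j)%N]
    (mixing_time K mu delta) by [].
rewrite /mixing_time; case: xgetP => [_ -> //|/(_ t)]; case; split => // j jP.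
by apply: tmin; exact/asboolP.
Qed.

Lemma kpow_le_mixing_dist k (delta : R) x A : measurable A ->
  (mixing_dist K mu k <= delta%:E)%E ->
  (kpow K k x A <= mu A + delta%:E)%E.
Proof.
move=> mA mix.
have : (`|kpow K k x A - mu A| <= delta%:E)%E.
  apply: le_trans mix; apply: (@le_trans _ _ (tv_dist (kpow K k x) mu)).
    by apply: ereal_sup_ubound; exists A.
  by apply: ereal_sup_ubound; exists x.
move=> /(le_trans (lee_abs _)); rewrite leeBlDl//.
by rewrite fin_num_measure.
Qed.

End mixing.

(** * Almost surely bounded random variables *)

Section bounded_random_variables.
Context {d : measure_display} {Omega : measurableType d} {R : realType}
  {n : nat}.
Variable P : probability Omega R.
Implicit Types (f g : Omega -> R) (u v : Omega -> 'rV[R]_n).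

(** Boundedness is almost sure because the noise bound is; on a probability space it already yields
    integrability. *)
Definition bounded_rv f : Prop :=
  measurable_fun setT f /\ exists M, {ae P, forall om, `|f om| <= M}.

Definition bounded_rvec u : Prop :=
  measurable_fun setT u /\ exists M, {ae P, forall om, enorm (u om) <= M}.

Lemma bounded_rv_integrable f : bounded_rv f -> P.-integrable setT (EFin \o f).
Proof. by move=> [mf [M fM]]; exact: integrable_ae_bounded mf fM. Qed.

Lemma bounded_rv_integral f : bounded_rv f ->
  (\int[P]_om (f om)%:E)%E = (\int[P]_om f om)%:E.
Proof.
move=> bf; rewrite fineK//; apply: integrable_fin_num => //.
exact: bounded_rv_integrable.
Qed.

Lemma bounded_rv_cst (c : R) : bounded_rv (fun=> c).
Proof. by split; [exact: measurable_cst|exists `|c|; exact: aeW]. Qed.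

Lemma bounded_rvD f g : bounded_rv f -> bounded_rv g ->
  bounded_rv (fun om => f om + g om).
Proof.
move=> [mf [M fM]] [mg [N gN]]; split; first exact: measurable_funD.
exists (M + N); apply: filterS2 fM gN => om fM gN.
by rewrite (le_trans (ler_normD _ _))// lerD.
Qed.

Lemma bounded_rvM f g : bounded_rv f -> bounded_rv g ->
  bounded_rv (fun om => f om * g om).
Proof.
move=> [mf [M fM]] [mg [N gN]]; split; first exact: measurable_funM.
by exists (M * N); apply: filterS2 fM gN => om fM gN; rewrite normrM ler_pM.
Qed.

Lemma bounded_rvZ (c : R) f : bounded_rv f -> bounded_rv (fun om => c * f om).
Proof. exact/bounded_rvM/bounded_rv_cst. Qed.

Lemma bounded_RintegralD f g : bounded_rv f -> bounded_rv g ->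
  \int[P]_om (f om + g om) = \int[P]_om f om + \int[P]_om g om.
Proof. by move=> bf bg; rewrite RintegralD//; exact: bounded_rv_integrable. Qed.

Lemma bounded_RintegralZ (c : R) f : bounded_rv f ->
  \int[P]_om (c * f om) = c * \int[P]_om f om.
Proof. by move=> bf; rewrite RintegralZl//; exact: bounded_rv_integrable. Qed.

Lemma Rintegral_prob_cst (c : R) : \int[P]_om c = c.
Proof. by rewrite Rintegral_cst// [X in fine X]probability_setT mulr1. Qed.

Lemma bounded_rvec_cst (c : 'rV[R]_n) : bounded_rvec (fun=> c).
Proof. by split; [exact: measurable_cst|exists (enorm c); exact: aeW]. Qed.

Lemma bounded_rvecB u v : bounded_rvec u -> bounded_rvec v ->
  bounded_rvec (fun om => u om - v om).
Proof.
move=> [mu [M uM]] [mv [N vN]]; split; first exact: measurable_fun_rVB.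
exists (M + N); apply: filterS2 uM vN => om uM vN.
by rewrite (le_trans (ler_enormD _ _))// enormN lerD.
Qed.

Lemma bounded_rvec_enorm u :
  bounded_rvec u -> bounded_rv (fun om => enorm (u om)).
Proof.
move=> [mu [M uM]]; split; first exact: measurable_fun_enorm.
exists M; move: uM; apply: filterS => om uM.
by rewrite ger0_norm// enorm_ge0.
Qed.

Lemma bounded_rvec_dotv u v : bounded_rvec u -> bounded_rvec v ->
  bounded_rv (fun om => dotv (u om) (v om)).
Proof.
move=> [mu [M uM]] [mv [N vN]]; split; first exact: measurable_fun_dotv.
exists (M * N); apply: filterS2 uM vN => om uM vN.
by rewrite (le_trans (normr_dotv _ _))// ler_pM// enorm_ge0.
Qed.

Lemma bounded_rvec_le u f : measurable_fun setT u -> bounded_rv f ->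
  {ae P, forall om, enorm (u om) <= f om} -> bounded_rvec u.
Proof.
move=> mu [_ [M fM]] uf; split => //; exists M.
apply: filterS2 fM uf => om fM /le_trans; apply.
exact: le_trans (ler_norm _) fM.
Qed.

(** [Rintegral_mul_eq0] applies to each coordinate, the coordinates of [u] being known to [G]. *)
Lemma Rintegral_dotv_eq0 (G : set (set Omega)) u v :
  G `<=` measurable ->
  (forall A, measurable A -> G (u @^-1` A)) ->
  bounded_rvec u -> bounded_rvec v ->
  (forall (j : 'I_n) B, G B -> \int[P]_(om in B) (v om 0 j)%:E = 0)%E ->
  \int[P]_om dotv (u om) (v om) = 0.
Proof.
move=> Gm Gu [mu [M uM]] [mv [N vN]] v0.
have bcoord (z : Omega -> 'rV[R]_n) C j : measurable_fun setT z ->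
    {ae P, forall om, enorm (z om) <= C} -> bounded_rv (fun om => z om 0 j).
  move=> /measurable_fun_rVP mz zC; split => //; exists C.
  by apply: filterS zC => om; apply: le_trans; exact: normr_coord_enorm.
have buv j : bounded_rv (fun om => u om 0 j * v om 0 j).
  by apply: bounded_rvM; [exact: bcoord uM|exact: bcoord vN].
rewrite /Rintegral; under eq_integral do rewrite -sumEFin.
rewrite integral_sum//; last by move=> j; exact: bounded_rv_integrable (buv j).
rewrite big1// => j _; rewrite (bounded_rv_integral (buv j)).
rewrite (@Rintegral_mul_eq0 _ _ _ _ G M)//.
- move=> A mA; apply: (Gu [set z | A (z 0 j)]).
  by rewrite -[X in measurable X]setTI; exact: measurable_coord.
- by apply: filterS uM => om; apply: le_trans; exact: normr_coord_enorm.
- exact: bounded_rv_integrable (bcoord _ _ _ mv vN).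
- exact: v0.
Qed.

End bounded_random_variables.

(** * Mean square error of the iterates *)

Section iterates.
Context {d dS : measure_display} {Omega : measurableType d}
  {S : measurableType dS} {R : realType} {n : nat}.
Variables (F : S -> 'rV[R]_n -> 'rV[R]_n) (K : R.-pker S ~> S)
  (mu : probability S R) (P : probability Omega R)
  (X : nat -> {RV P >-> S}) (w : nat -> {RV P >-> 'rV[R]_n})
  (theta0 thetas : 'rV[R]_n) (theta : nat -> Omega -> 'rV[R]_n)
  (L1 L2 c0 alpha : R).
Hypotheses (mF : measurable_fun [set: S * 'rV[R]_n]
    (fun z : S * 'rV[R]_n => F z.1 z.2))
  (lipF : lipschitz_operator F L1)
  (iterates : sa_iterates F (fun=> alpha) X w theta0 theta)
  (markovX : markov_chain P (history theta X w) K X)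
  (noise : martingale_noise P (history theta X w) theta w L2)
  (alpha_ge0 : 0 <= alpha).

Local Notation L := (L1 + L2).
Local Notation G := (history theta X w).
Local Notation Fbar := (mean_field F mu).

Let L1_gt0 : 0 < L1. Proof. by case: lipF. Qed.
Let L2_gt0 : 0 < L2. Proof. by case: noise. Qed.
Let L_ge0 : 0 <= L. Proof. by rewrite addr_ge0// ltW. Qed.

Lemma measurable_operator_comp (Y : Omega -> S) (Z : Omega -> 'rV[R]_n) :
  measurable_fun setT Y -> measurable_fun setT Z ->
  measurable_fun setT (fun om => F (Y om) (Z om)).
Proof.
move=> mY mZ.
exact: (measurableT_comp mF (measurable_fun_pair mY mZ)).
Qed.

Lemma measurable_iterates k : measurable_fun setT (theta k).
Proof.
have [theta_0 theta_S] := iterates; elim: k => [|k IH].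
  by rewrite (_ : theta 0%N = fun=> theta0)//; apply/funext.
rewrite (_ : theta k.+1 = fun om =>
  theta k om + alpha *: (F (X k om) (theta k om) + w k om)); last first.
  by apply/funext => om; rewrite theta_S.
apply: measurable_fun_rVD => //; apply: measurable_fun_rVZ.
by apply: measurable_fun_rVD => //; exact: measurable_operator_comp.
Qed.

Lemma history_measurable k : G k `<=` measurable.
Proof.
apply: smallest_sub; first exact: sigma_algebra_measurable.
move=> B [[|]|] [i _ [A mA ->]]; rewrite -[X in measurable X]setTI.
- exact: measurable_iterates.
- exact: measurable_funP.
- exact: measurable_funP.
Qed.

Lemma history_sigma_algebra k : sigma_algebra setT (G k).
Proof. exact: smallest_sigma_algebra. Qed.

Lemma history_theta k A : measurable A -> G k (theta k @^-1` A).
Proof.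
by move=> mA; apply: sub_sigma_algebra; left; left; exists k => //; exists A.
Qed.

Lemma history_X k A : measurable A -> G k (X k @^-1` A).
Proof.
by move=> mA; apply: sub_sigma_algebra; left; right; exists k => //; exists A.
Qed.

Lemma historyS k : G k `<=` G k.+1.
Proof.
apply: smallest_sub; first exact: smallest_sigma_algebra.
move=> B BG; apply: sub_sigma_algebra; move: BG.
move=> [[|]|] [i ik [A mA ->]]; [left; left|left; right|right];
  by exists i; [exact: leqW|exists A].
Qed.

(** One null set serves all times, as the pathwise estimates follow the iterates over a whole
    window. *)
Lemma ae_noise_le : {ae P, forall om k,
  enorm (w k om) <= L2 * (enorm (theta k om) + 1)}.
Proof. by apply: ae_foralln => k; case: noise. Qed.

Lemma increment_le om k : enorm (w k om) <= L2 * (enorm (theta k om) + 1) ->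
  enorm (F (X k om) (theta k om) + w k om) <= L * (enorm (theta k om) + 1).
Proof.
move=> wk; rewrite (le_trans (ler_enormD _ _))// mulrDl lerD//.
exact: enorm_operator_le.
Qed.

Lemma iterate_step_le om k : enorm (w k om) <= L2 * (enorm (theta k om) + 1) ->
  enorm (theta k.+1 om - theta k om) <= alpha * L * (enorm (theta k om) + 1).
Proof.
move=> wk; rewrite (iterates.2 k om) addrC addKr enormZ// -mulrA ler_wpM2l//.
exact: increment_le.
Qed.

Lemma bounded_iterates k : bounded_rvec P (theta k).
Proof.
split; first exact: measurable_iterates.
exists ((1 + alpha * L) ^+ k * (enorm theta0 + 1)).
apply: filterS ae_noise_le => om wom.
(* Adding 1 to the norm makes the growth recursion purely multiplicative. *)
suff : enorm (theta k om) + 1 <= (1 + alpha * L) ^+ k * (enorm theta0 + 1).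
  by apply: le_trans; rewrite lerDl.
elim: k => [|k IH]; first by rewrite expr0 mul1r (iterates.1 om).
have step := iterate_step_le (wom k).
have := ler_enormD (theta k.+1 om - theta k om) (theta k om); rewrite subrK.
have aL : 0 <= 1 + alpha * L by rewrite addr_ge0// mulr_ge0.
have := ler_wpM2l aL IH; rewrite mulrA -exprS => IH' tri.
by apply: le_trans IH'; rewrite mulrDl mul1r; lra.
Qed.

Lemma bounded_error k : bounded_rvec P (fun om => theta k om - thetas).
Proof. exact/bounded_rvecB/bounded_rvec_cst/bounded_iterates. Qed.

Lemma bounded_affine_iterates (c : R) k :
  bounded_rv P (fun om => c * (enorm (theta k om) + 1)).
Proof.
apply: bounded_rvZ; apply: bounded_rvD (bounded_rv_cst _ _).
exact/bounded_rvec_enorm/bounded_iterates.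
Qed.

Lemma bounded_noise k : bounded_rvec P (w k).
Proof.
apply: bounded_rvec_le (bounded_affine_iterates L2 k) _ => //.
by case: noise.
Qed.

Lemma bounded_operator j k : bounded_rvec P (fun om => F (X j om) (theta k om)).
Proof.
apply: bounded_rvec_le (bounded_affine_iterates L1 k) _.
  exact/measurable_operator_comp/measurable_iterates.
by apply: aeW => om; exact: enorm_operator_le.
Qed.

Lemma bounded_mean_field k : bounded_rvec P (fun om => Fbar (theta k om)).
Proof.
apply: bounded_rvec_le (bounded_affine_iterates L1 k) _.
  apply: measurableT_comp; last exact: measurable_iterates.
  exact: measurable_mean_field.
by apply: aeW => om; exact: enorm_mean_field_le.
Qed.

Lemma bounded_sqr_error k :
  bounded_rv P (fun om => enorm (theta k om - thetas) ^+ 2).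
Proof.
by under eq_fun do rewrite expr2; apply: bounded_rvM;
  exact/bounded_rvec_enorm/bounded_error.
Qed.

Lemma expected_noise_eq0 k :
  \int[P]_om dotv (theta k om - thetas) (w k om) = 0.
Proof.
have [_ martingale _] := noise.
apply: (@Rintegral_dotv_eq0 _ _ _ _ _ (G k)).
- exact: history_measurable.
- move=> A mA; apply: (@history_theta k [set v | A (v - thetas)]).
  rewrite -[X in measurable X]setTI.
  by apply: (measurable_fun_rVB _ _ measurableT) mA.
- exact: bounded_error.
- exact: bounded_noise.
- move=> j B GB; have [_ _ _ ->] := martingale k j => //.
  by rewrite integral0.
Qed.

(** The Markovian error with the iterate frozen at time [m]; its conditional mean would vanish if
    [X (m + t)] had law [mu] given the history at time [m]. *)
Definition bias m t om :=
  dotv (theta m om - thetas)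
    (F (X (m + t)%N om) (theta m om) - Fbar (theta m om)).

(** Cauchy-Schwarz bound on [dotv (theta m om - thetas) (F x (theta m om))], uniform in the state
    [x]. *)
Definition bias_scale m om :=
  L1 * (enorm (theta m om) + 1) * enorm (theta m om - thetas).

Lemma bounded_bias m t : bounded_rv P (bias m t).
Proof.
apply: bounded_rvec_dotv; first exact: bounded_error.
by apply: bounded_rvecB; [exact: bounded_operator|exact: bounded_mean_field].
Qed.

Lemma bounded_bias_scale m : bounded_rv P (bias_scale m).
Proof.
apply: bounded_rvM; first exact: bounded_affine_iterates.
exact/bounded_rvec_enorm/bounded_error.
Qed.

(* [bias_scale m] is added to the integrand to make it nonnegative. *)
Lemma expected_bias_le m t (delta : R) : 0 <= delta ->
  (forall x A, measurable A -> kpow K t x A <= mu A + delta%:E)%E ->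
  \int[P]_om bias m t om <= 2 * delta * \int[P]_om bias_scale m om.
Proof.
move=> delta0 mix.
pose g (z : 'rV[R]_n * S) := dotv (z.1 - thetas) (F z.2 z.1) +
  L1 * (enorm z.1 + 1) * enorm (z.1 - thetas).
have mg : measurable_fun setT g.
  apply: measurable_funD.
    apply: measurable_fun_dotv; first exact: measurable_fun_rVB.
    exact: (measurableT_comp mF
      (measurable_fun_pair measurable_snd measurable_fst)).
  apply: measurable_funM; last first.
    by apply: measurable_fun_enorm; exact: measurable_fun_rVB.
  apply: measurable_funM => //; apply: measurable_funD => //.
  exact: measurable_fun_enorm.
have dot_le v x : `|dotv (v - thetas) (F x v)| <=
    L1 * (enorm v + 1) * enorm (v - thetas).
  rewrite mulrC (le_trans (normr_dotv _ _))// ler_wpM2l ?enorm_ge0//.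
  exact: enorm_operator_le.
have g_ge0 z : 0 <= g z.
  by have := dot_le z.1 z.2; rewrite ler_norml /g => /andP[+ _]; lra.
(* The range of [g] has twice the length of the scale, whence the factor 2 in the conclusion. *)
have g_le v x : g (v, x) <= 2 * (L1 * (enorm v + 1) * enorm (v - thetas)).
  by have := dot_le v x; rewrite ler_norml /g/= => /andP[_ +]; lra.
pose h z := (g z)%:E.
have mh : measurable_fun setT h by exact/measurable_EFinP.
have h_ge0 z : (0 <= h z)%E by rewrite lee_fin.
(* The integral of [g] over the state under [mu], as [hmu] shows. *)
pose c om := dotv (theta m om - thetas) (Fbar (theta m om)) + bias_scale m om.
have bc : bounded_rv P c.
  apply: bounded_rvD (bounded_bias_scale m).
  by apply: bounded_rvec_dotv; [exact: bounded_error|exact: bounded_mean_field].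
have hmu om : (\int[mu]_x h (theta m om, x) = (c om)%:E)%E.
  pose dotF x := dotv (theta m om - thetas) (F x (theta m om)).
  have bdotF : bounded_rv mu dotF.
    split.
      apply: measurable_fun_dotv => //; exact: measurable_operator.
    exists (bias_scale m om); apply: aeW => x; exact: dot_le.
  have bcst := bounded_rv_cst mu (bias_scale m om).
  rewrite (bounded_rv_integral (bounded_rvD bdotF bcst)).
  rewrite (bounded_RintegralD bdotF bcst) Rintegral_prob_cst /c.
  by rewrite (dotv_mean_field _ mF lipF).
(* The mean-field terms cancel in [bias m t om + c om], leaving [g] at [(theta m om, X (m + t) om)].
   The Markov property replaces the state by the kernel [kpow K t], which is then compared with
   [mu]; [c] cancels afterwards. *)
have main : (\int[P]_om (bias m t om + c om)%:E <=
    \int[P]_om (2 * delta * bias_scale m om + c om)%:E)%E.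
  under eq_integral => om _.
    rewrite (_ : (bias m t om + c om)%:E = h (theta m om, X (m + t)%N om)).
      over.
    congr EFin; rewrite /bias /c /g /bias_scale/= dotvDr dotvNr; ring.
  have markov := ge0_integral_markov history_sigma_algebra history_measurable
    historyS history_X markovX t (@history_theta m) mh h_ge0.
  rewrite markov; apply: ge0_le_integral => //.
  - by move=> om _; exact: integral_ge0.
  - pose g' (z : ('rV[R]_n * S) * S) := h (z.1.1, z.2).
    have mg' : measurable_fun setT g'.
      apply: (measurableT_comp mh); apply: measurable_fun_pair => //.
      by apply: measurableT_comp => //; exact: measurableT_comp.
    have mint := measurable_fun_integral_sfinite_kernel g'
      (kernel.kernel_snd (kpow K t)) (fun z => h_ge0 _) mg'.
    have mZ : measurable_fun setT (fun om => (theta m om, X m om)).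
      by apply: measurable_fun_pair => //; exact: measurable_iterates.
    exact: (measurableT_comp mint mZ).
  - apply/measurable_EFinP.
    by case: (bounded_rvD (bounded_rvZ (2 * delta) (bounded_bias_scale m)) bc).
  - move=> om _; rewrite addrC EFinD -hmu mulrAC.
    apply: le_integral_close_measures => //.
    + by apply: (measurable_fun_pair2 _ mg).
    + by move=> x; rewrite g_ge0 g_le.
    + exact: sprob_kernel_le1.
    + by move=> A mA; exact: mix.
have b1 := bounded_rvD (bounded_bias m t) bc.
have bZ := bounded_rvZ (2 * delta) (bounded_bias_scale m).
have b2 := bounded_rvD bZ bc.
move: main; rewrite (bounded_rv_integral b1) (bounded_rv_integral b2) lee_fin.
rewrite (bounded_RintegralD (bounded_bias m t) bc) (bounded_RintegralD bZ bc).
by rewrite lerD2r (bounded_RintegralZ _ (bounded_bias_scale m)).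
Qed.

Lemma iterate_displacement_le m t om :
  (forall k, enorm (w k om) <= L2 * (enorm (theta k om) + 1)) ->
  2 * (alpha * L * t%:R) <= 1 ->
  enorm (theta (m + t)%N om - theta m om) <=
    2 * (alpha * L * t%:R) * (enorm (theta m om) + 1).
Proof.
move=> wom small; apply: (enorm_displacement_le (th := theta ^~ om)) => //.
  exact: mulr_ge0.
by move=> j _; exact: iterate_step_le.
Qed.

Hypotheses (diss : dissipative F mu thetas c0) (L_ge1 : 1 <= L).

Local Notation err k := (\int[P]_om (enorm (theta k om - thetas) ^+ 2)).
Local Notation s2 := ((enorm thetas + 1) ^+ 2).

(** The constant is [45 = 36 + 9], with 36 from the pathwise estimate and 9 from the expected bias;
    the noise term has mean 0. *)
Lemma expected_error_step m t :
  (1 <= t)%N -> alpha * L * t%:R <= 130^-1 ->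
  (forall x A, measurable A -> kpow K t x A <= mu A + alpha%:E)%E ->
  err (m + t).+1 <= (1 - 2 * (c0 * alpha)) * err (m + t) +
    45 * (alpha * (alpha * L * t%:R) * L) * (err (m + t) + s2).
Proof.
move=> t1 p130 mix.
set p := alpha * L * t%:R; set k := (m + t)%N.
have aL0 : 0 <= alpha * L by exact: mulr_ge0.
have aLp : alpha * L <= p.
  by rewrite /p ler_peMr// ler1n.
have p0 : 0 <= p := le_trans aL0 aLp.
have pP : 0 <= p <= 130^-1 by rewrite p0.
have near om : (forall j, enorm (w j om) <= L2 * (enorm (theta j om) + 1)) ->
    enorm (theta k om - theta m om) <= 2 * p * (enorm (theta m om) + 1).
  by move=> wom; apply: iterate_displacement_le => //; rewrite -/p; lra.
have bsq := bounded_sqr_error k.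
have bW : bounded_rv P (fun om => dotv (theta k om - thetas) (w k om)).
  by apply: bounded_rvec_dotv; [exact: bounded_error|exact: bounded_noise].
have bsum := bounded_rvD bsq (bounded_rv_cst P s2).
have IsumE : \int[P]_om (enorm (theta k om - thetas) ^+ 2 + s2) = err k + s2.
  by rewrite (bounded_RintegralD bsq (bounded_rv_cst P s2)) Rintegral_prob_cst.
have step : err k.+1 <= \int[P]_om (
    (1 - 2 * (c0 * alpha)) * enorm (theta k om - thetas) ^+ 2 +
    2 * alpha * dotv (theta k om - thetas) (w k om) +
    2 * alpha * bias m t om +
    36 * (alpha * p * L) * (enorm (theta k om - thetas) ^+ 2 + s2)).
  apply: ae_le_Rintegral.
  - exact/bounded_rv_integrable/bounded_sqr_error.
  - apply: bounded_rv_integrable.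
    apply: bounded_rvD (bounded_rvZ _ bsum).
    apply: bounded_rvD (bounded_rvZ _ (bounded_bias m t)).
    exact: bounded_rvD (bounded_rvZ _ bsq) (bounded_rvZ _ bW).
  - apply: filterS ae_noise_le => om wom; rewrite (iterates.2 k om).
    have [_ lip _] := lipF; have [_ _ _ dis] := diss.
    have leL v : 0 <= v -> L1 * v <= L * v.
      by move=> v0; rewrite ler_wpM2r// lerDl ltW.
    apply: one_step_le => //.
    + exact: near.
    + apply: le_trans (enorm_operator_le lipF _ _) _.
      by apply: leL; rewrite addr_ge0 ?enorm_ge0.
    + apply: le_trans (enorm_mean_field_le _ mF lipF _) _.
      by apply: leL; rewrite addr_ge0 ?enorm_ge0.
    + by apply: le_trans (lip _ _ _) _; exact/leL/enorm_ge0.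
    + apply: le_trans (mean_field_lipschitz _ mF lipF _ _) _.
      exact/leL/enorm_ge0.
    + exact: increment_le.
(* Both factors cost [102 / 100] and [(D + s) ^+ 2 <= 2 * (D ^+ 2 + s ^+ 2)]; indeed
   [2 * (102 / 100) ^+ 2 <= 21 / 10]. *)
have scale_le : \int[P]_om bias_scale m om <= 21 / 10 * L * (err k + s2).
  rewrite -IsumE -RintegralZl//; last exact: bounded_rv_integrable.
  apply: ae_le_Rintegral.
  - exact/bounded_rv_integrable/bounded_bias_scale.
  - exact: bounded_rv_integrable (bounded_rvZ _ bsum).
  - apply: filterS ae_noise_le => om wom.
    have [Ar_le Na_le] := near_iterate_distance_le thetas pP (near om wom).
    rewrite /bias_scale.
    set D := enorm (theta k om - thetas) in Ar_le Na_le *.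
    set s := enorm thetas + 1 in Ar_le Na_le *.
    have N0 := enorm_ge0 (theta m om).
    have prod_le : (enorm (theta m om) + 1) * enorm (theta m om - thetas) <=
        (102 / 100 * (D + s)) * (102 / 100 * (D + s)).
      by apply: ler_pM => //; [rewrite addr_ge0|exact: enorm_ge0].
    have sq : (102 / 100 * (D + s)) * (102 / 100 * (D + s)) <=
        21 / 10 * (D ^+ 2 + s ^+ 2).
      have := sqr_ge0 (D - s); have := sqr_ge0 D; have := sqr_ge0 s; lra.
    rewrite -mulrA (le_trans (ler_wpM2l (ltW L1_gt0) (le_trans prod_le sq)))//.
    rewrite [21 / 10 * L]mulrC -[leRHS]mulrA; apply: ler_wpM2r.
      by rewrite mulr_ge0// addr_ge0 ?sqr_ge0.
    by rewrite lerDl ltW.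
have bias_le := expected_bias_le m alpha_ge0 mix.
have b1 := bounded_rvZ (1 - 2 * (c0 * alpha)) bsq.
have b2 := bounded_rvZ (2 * alpha) bW.
have b3 := bounded_rvZ (2 * alpha) (bounded_bias m t).
have b4 := bounded_rvZ (36 * (alpha * p * L)) bsum.
have b12 := bounded_rvD b1 b2.
move: step; rewrite (bounded_RintegralD (bounded_rvD b12 b3) b4).
rewrite (bounded_RintegralD b12 b3) (bounded_RintegralD b1 b2).
rewrite (bounded_RintegralZ _ bsq) (bounded_RintegralZ _ bW).
rewrite (bounded_RintegralZ _ (bounded_bias m t)) (bounded_RintegralZ _ bsum).
rewrite IsumE expected_noise_eq0 mulr0 addr0 => step.
have err0 : 0 <= err k + s2.
  by rewrite -IsumE; apply: Rintegral_ge0 => om _; rewrite addr_ge0 ?sqr_ge0.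
(* [2 * 2 * (21 / 10) = 84 / 10 <= 9], and [alpha * L <= p <= p * L]. *)
have bias_le' : 2 * alpha * \int[P]_om bias m t om <=
    9 * (alpha * p * L) * (err k + s2).
  have a2 : 0 <= 2 * alpha by rewrite mulr_ge0.
  have := ler_wpM2l a2 (le_trans bias_le (ler_wpM2l a2 scale_le)).
  move/le_trans; apply.
  have -> : 2 * alpha * (2 * alpha * (21 / 10 * L * (err k + s2))) =
    84 / 10 * alpha * (alpha * L * (err k + s2)) by ring.
  have : alpha * (alpha * L * (err k + s2)) <= alpha * (p * L * (err k + s2)).
    apply: ler_wpM2l => //; apply: ler_wpM2r => //.
    by rewrite (le_trans aLp)// ler_peMr.
  have : 0 <= alpha * (p * L * (err k + s2)) by rewrite !mulr_ge0.
  lra.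
by move: step bias_le'; rewrite -/k; lra.
Qed.

(** During the first [t] steps the iterate moves by at most [enorm theta0 + 1]; the triangle
    inequality through [theta0] does the rest. *)
Lemma expected_error_base t :
  alpha * L * t%:R <= 130^-1 ->
  err t <= (enorm theta0 + enorm (theta0 - thetas) + 1) ^+ 2.
Proof.
move=> p130; have p0 : 0 <= alpha * L * t%:R by rewrite !mulr_ge0.
rewrite -[leRHS](Rintegral_prob_cst P); apply: ae_le_Rintegral.
- exact/bounded_rv_integrable/bounded_sqr_error.
- exact/bounded_rv_integrable/bounded_rv_cst.
- apply: filterS ae_noise_le => om wom.
  have theta_0 := iterates.1 om.
  have small : 2 * (alpha * L * t%:R) <= 1 by lra.
  have := iterate_displacement_le 0 wom small; rewrite add0n theta_0 => disp.
  have tri := ler_enorm_triangle (theta t om) theta0 thetas.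
  have N0 := enorm_ge0 theta0; have D0 := enorm_ge0 (theta0 - thetas).
  have slack : 0 <= (1 - 2 * (alpha * L * t%:R)) * (enorm theta0 + 1).
    by apply: mulr_ge0; lra.
  rewrite ler_pXn2r ?nnegrE ?enorm_ge0//; last by rewrite !addr_ge0.
  lra.
Qed.

(** Induction on [i], each step freezing the iterate at time [i], that is [t] steps before the
    current time [i + t]. *)
Lemma expected_error_le t i :
  (0 < n)%N -> (1 <= t)%N -> alpha * t%:R <= c0 / (130 * L ^+ 2) ->
  (forall x A, measurable A -> kpow K t x A <= mu A + alpha%:E)%E ->
  err (i + t)%N <=
    (enorm theta0 + enorm (theta0 - thetas) + 1) ^+ 2 * (1 - c0 * alpha) ^+ i +
    130 * L ^+ 2 * (enorm thetas + 1) ^+ 2 * (alpha * t%:R / c0).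
Proof.
move=> n_gt0 t1 small mix; have [_ _ c0_gt0 _] := diss.
have L_gt0 : 0 < L := lt_le_trans ltr01 L_ge1.
have c0L1 := dissipative_le_lipschitz mF lipF n_gt0 diss.
have L2_pos : 0 < 130 * L ^+ 2 by rewrite mulr_gt0// exprn_gt0.
have atL : 130 * L * (alpha * L * t%:R) <= c0.
  have -> : 130 * L * (alpha * L * t%:R) = alpha * t%:R * (130 * L ^+ 2) by ring.
  by rewrite -ler_pdivlMr.
(* From [130 * L * p <= c0 <= L1 <= L], with [p] for [alpha * L * t]. *)
have p130 : alpha * L * t%:R <= 130^-1.
  rewrite -(ler_pM2l (_ : 0 < 130 * L)); last by rewrite mulr_gt0.
  apply: le_trans atL _.
  by rewrite mulrAC divff// mul1r (le_trans c0L1)// lerDl ltW.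
(* Keeps the contraction factor nonnegative, so that the induction hypothesis can be multiplied by
   it. *)
have c0a : c0 * alpha <= 1.
  have aLt : alpha * L <= alpha * L * t%:R by rewrite ler_peMr ?ler1n// mulr_ge0.
  have : c0 * alpha <= L * alpha.
    by rewrite ler_wpM2r// (le_trans c0L1)// lerDl ltW.
  lra.
set beta1 := (_ + _ + 1) ^+ 2; set s2 := (enorm thetas + 1) ^+ 2.
have s2_ge0 : 0 <= s2 by exact: sqr_ge0.
elim: i => [|i IH].
  rewrite add0n expr0 mulr1 (le_trans (expected_error_base p130))// lerDl.
  by rewrite !mulr_ge0 ?invr_ge0 ?(ltW c0_gt0)// addr_ge0 ?enorm_ge0.
have := expected_error_step i t1 p130 mix; rewrite addSn -/s2 => step.
have e0 : 0 <= err (i + t)%N by apply: Rintegral_ge0 => om _; rewrite sqr_ge0.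
set e := err (i + t)%N in IH step e0.
set C := 130 * L ^+ 2 * s2 * (alpha * t%:R / c0) in IH *.
(* In one step the contraction removes [c0 * alpha * C], which is 130 times [alpha * p * L * s2] and
   so covers the 45 times that quantity which the step adds. *)
have c0C : c0 * C = 130 * (L * (alpha * L * t%:R)) * s2.
  by rewrite /C; field; exact: lt0r_neq0.
have ae := mulr_ge0 alpha_ge0 e0; have as2 := mulr_ge0 alpha_ge0 s2_ge0.
(* Bounds the error proportional to [e] by [c0 * alpha * e], which uses up one half of the drift
   [2 * (c0 * alpha)]. *)
have drift := ler_wpM2r ae atL.
have noise_s2 : 0 <= alpha * (L * (alpha * L * t%:R)) * s2.
  by do !(apply: mulr_ge0 => //).
have ac0C : c0 * alpha * C = 130 * (alpha * (L * (alpha * L * t%:R)) * s2).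
  by rewrite mulrAC c0C; ring.
have contraction :
    0 <= (1 - c0 * alpha) * (beta1 * (1 - c0 * alpha) ^+ i + C - e).
  by apply: mulr_ge0; rewrite subr_ge0.
have drift_e : 0 <= alpha * (L * (alpha * L * t%:R)) * e.
  by do !(apply: mulr_ge0 => //).
rewrite exprS; move: step drift noise_s2 drift_e ac0C contraction; lra.
Qed.

End iterates.

(** The condition [1 <= t] gives [alpha * L <= alpha * L * t], so that the quadratic term and the
    mixing error are absorbed in the displacement error; [0 < n] supplies the vector behind
    [c0 <= L1]. *)
Theorem corollary2p1p1 (R : realType) (nX n : nat) (n_gt0 : (0 < n)%N)
  (S : set 'rV[R]_nX) (S0 : S !=set0)
  (F : subspaceType S0 -> 'rV[R]_n -> 'rV[R]_n)
  (mF : measurable_fun [set: subspaceType S0 * 'rV[R]_n]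
          (fun z : subspaceType S0 * 'rV[R]_n => F z.1 z.2))
  (K : R.-pker (subspaceType S0) ~> (subspaceType S0))
  (muX : probability (subspaceType S0) R)
  (d : measure_display) (Omega : measurableType d) (Pr : probability Omega R)
  (X : nat -> {RV Pr >-> subspaceType S0})
  (w : nat -> {RV Pr >-> 'rV[R]_n})
  (theta0 thetas : 'rV[R]_n) (theta : nat -> Omega -> 'rV[R]_n)
  (L1 L2 c0 alpha : R)
  (iterates : sa_iterates F (fun _ => alpha) X w theta0 theta)
  (markovX : markov_chain Pr (history theta X w) K X)
  (A1 : lipschitz_operator F L1)
  (A2 : dissipative F muX thetas c0)
  (A3_1 : uniformly_geometrically_ergodic K muX)
  (A3_2 : martingale_noise Pr (history theta X w) theta w L2)
  (L_ge1 : 1 <= L1 + L2)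
  (alpha01 : 0 < alpha < 1) :
  let L := L1 + L2 in
  let t := mixing_time K muX alpha in
  let beta1 := (enorm theta0 + enorm (theta0 - thetas) + 1) ^+ 2 in
  let beta2 := 130 * L ^+ 2 * (enorm thetas + 1) ^+ 2 in
  (1 <= t)%N ->
  alpha * t%:R <= c0 / (130 * L ^+ 2) ->
  forall k, (t <= k)%N ->
    ('E_Pr[(fun om => enorm (theta k om - thetas) ^+ 2)%R] <=
      (beta1 * (1 - c0 * alpha) ^+ (k - t) + beta2 * (alpha * t%:R / c0))%:E)%E.
Proof.
move=> L t beta1 beta2 t1 small k tk; have /andP[alpha0 alpha1] := alpha01.
have alpha_ge0 := ltW alpha0.
have mix x A : measurable A -> (kpow K t x A <= muX A + alpha%:E)%E.
  by move=> mA; apply: kpow_le_mixing_dist => //; exact: mixing_dist_mixing_time.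
rewrite unlock (bounded_rv_integral
  (bounded_sqr_error thetas mF A1 iterates A3_2 alpha_ge0 k)) lee_fin.
have := expected_error_le mF A1 iterates markovX A3_2 alpha_ge0 A2 L_ge1 (k - t)
  n_gt0 t1 small mix.
by rewrite subnK.
Qed.
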